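(* (a) Let $r\ge 3$ and let $m$ and $l$ be positive integers satisfying $\binom{l-1}{r} \le m \le \binom{l-1}{r} + \binom{l-2}{r-1}-(2^{r-3}-1)\left(\binom{l-2}{r-2}-1\right)$. Let $G$ be an $r$-uniform graph on $l$ vertices with $m$ edges that contains a clique of order $l-1$. Then $\lambda(G) = \lambda([l-1]^{(r)})$. (b) Let $m$ and $l$ be positive integers satisfying $\binom{l-1}{3} \le m \le \binom{l-1}{3} + \binom{l-2}{2}-(l-2)$. Let $G$ be a $3$-uniform graph with $m$ edges that does not contain a clique of order $l-1$. Then $\lambda(G) <\lambda([l-1]^{(3)})$.
   Context: An $r$-uniform graph ($r$-graph) $G$ consists of a vertex set $V(G)$ and an edge set $E(G)$ of $r$-element subsets of $V(G)$. A clique of order $t$ is a set of $t$ vertices all of whose $r$-subsets are edges; $[n]=\{1,\dots,n\}$ and $[n]^{(r)}$ denotes the complete $r$-graph on vertex set $[n]$. For an $r$-graph $G$ on vertex set $[n]$ and $\vec x\in S=\{\vec x\in\mathbb{R}^n:\sum_i x_i=1,\ x_i\ge 0\}$, set $\lambda(G,\vec x)=\sum_{i_1\cdots i_r\in E(G)}x_{i_1}\cdots x_{i_r}$; the Lagrangian of $G$ is $\lambda(G)=\max_{\vec x\in S}\lambda(G,\vec x)$. *)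

(* Defs.v *)
From HB Require Import structures.
From mathcomp Require Export all_boot all_order all_algebra.
From mathcomp Require Export all_classical all_reals all_analysis.
Export Order.TTheory GRing.Theory Num.Theory.
Export numFieldNormedType.Exports.

Set Implicit Arguments.
Unset Strict Implicit.
Unset Printing Implicit Defensive.

Local Open Scope classical_set_scope.
Local Open Scope ring_scope.

(* The vertex set [n] = {1, ..., n} is represented by 'I_n = {0, ..., n-1}. *)
Record uniform_graph (r n : nat) := UniformGraph {
  edges : {set {set 'I_n}};
  edges_card : forall e : {set 'I_n}, e \in edges -> #|e| = r
}.

Lemma complete_card (r n : nat) (e : {set 'I_n}) :
  e \in [set e : {set 'I_n} | #|e| == r]%SET -> #|e| = r.
Proof. by rewrite inE => /eqP. Qed.

Definition complete_graph (r n : nat) : uniform_graph r n :=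
  UniformGraph (@complete_card r n).

(* A set of fewer than r vertices satisfies the condition vacuously. *)
Definition is_clique (r n : nat) (G : uniform_graph r n)
    (K : {set 'I_n}) : Prop :=
  forall e : {set 'I_n}, e \subset K -> #|e| = r -> e \in edges G.

Definition has_clique (r n : nat) (G : uniform_graph r n) (t : nat) : Prop :=
  exists2 K : {set 'I_n}, #|K| = t & is_clique G K.

Definition simplex (R : realType) (n : nat) : set 'rV[R]_n :=
  [set x | (forall i, 0 <= x ord0 i) /\ \sum_i x ord0 i = 1].
Arguments simplex : clear implicits.

Definition weight (R : realType) (r n : nat) (G : uniform_graph r n)
    (x : 'rV[R]_n) : R :=
  \sum_(e in edges G) \prod_(i in e) x ord0 i.

(* For n > 0 this supremum is a maximum: see lagrangian_max below. For n = 0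
   the simplex is empty and the value is the junk value sup set0 = 0. *)
Definition lagrangian (R : realType) (r n : nat) (G : uniform_graph r n) : R :=
  sup [set weight G x | x in simplex R n].

Lemma simplex_compact (R : realType) (n : nat) : compact (simplex R n).
Proof.
pose C := [set v : 'rV[R]_n | forall i, `[0 : R, 1]%classic (v ord0 i)].
pose s (v : 'rV[R]_n) : R := \sum_i v ord0 i.
have sc : continuous s.
  apply: continuous_big => [|i _]; last exact: coord_continuous.
  exact: add_continuous.
have Cc : compact C.
  exact: (@rV_compact R n (fun=> `[0, 1]%classic)
    (fun=> @segment_compact R 0 1)).
have -> : simplex R n = C `&` s @^-1` [set x | x = 1].
  apply/seteqP; split=> v /= [v0 v1].
    split=> // i; rewrite /= in_itv /= v0 /= -v1 (bigD1 i) //= lerDl.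
    by apply: sumr_ge0 => j _.
  split=> // i; by have := v0 i; rewrite /= in_itv /= => /andP[].
apply: compact_closedI => //.
by apply: preimage_closed; [move=> v _; exact: sc | exact: closed_eq].
Qed.

Lemma lagrangian_max (R : realType) (r n : nat) (G : uniform_graph r n) :
  (0 < n)%N ->
  exists2 x, simplex R n x &
    weight G x = lagrangian R G /\
    forall y, simplex R n y -> weight G y <= lagrangian R G.
Proof.
case: n G => // n G _.
have wc : continuous (@weight R r n.+1 G).
  apply: continuous_big => [|e _]; first exact: add_continuous.
  apply: continuous_big => [|i _]; last exact: coord_continuous.
  exact: mul_continuous.
have S0 : simplex R n.+1 !=set0.
  exists (\row_j (j == ord0)%:R); split=> [i|]; first by rewrite mxE ler0n.
  rewrite (bigD1 ord0) //= mxE eqxx big1 ?addr0 // => i /negbTE i0.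
  by rewrite mxE i0.
have [x /set_mem Sx xmax] := EVT_max_rV S0 (@simplex_compact R n.+1)
  (continuous_subspaceT wc).
have ub : ubound [set weight G y | y in simplex R n.+1] (weight G x).
  by move=> _ [y Sy <-]; apply: xmax; exact: mem_set.
have hub : has_ubound [set weight G y | y in simplex R n.+1].
  by exists (weight G x).
have le y : simplex R n.+1 y -> weight G y <= lagrangian R G.
  by move=> Sy; apply: ub_le_sup => //; exists y.
exists x => //; split=> //; apply/eqP; rewrite eq_le le //=.
by apply: ge_sup => //; exists (weight G x), x.
Qed.

(* Main.v *)
(* Let x maximize the Lagrange polynomial. All partial derivatives agree on the
   support of x, where they equal r times the maximum.

   (a) Let v be the vertex outside the clique, B the link of v, T the clique, and
   assume that x is positive everywhere. Comparing derivatives at i, j in T gives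
   |x_i - x_j| <= x_v. Let u minimize x on T and put mu = x_u, t = x_v. Comparing
   derivatives at u and v gives
     (mu - t) * (weight of the edges containing both u and v, divided by mu t)
       = weight of the (r-1)-subsets of T that avoid both u and B.
   The bound on m provides 2^(r-3) missing sets for each edge through u and v, so
   (mu - t)(mu + t)^(r-2) < 2^(r-3) mu^(r-1) makes this impossible, unless no edge
   contains u and v. In that case moving all the weight of v to u changes nothing.

   (b) Put L = l - 1, let K = C(L,3) / L^3, and let (E, x) have the largest value M
   among all 3-graphs with at most m edges; suppose M >= K. It suffices that the
   support S of x has at most L vertices. Let v be the lightest vertex of S and
   t = x_v; deleting v leaves weight M (1 - 3t).
   If |S| = L + 1, Maclaurin's inequality on S - v shows that the missing triples
   of S - v weigh less than 3 K t^2, while each weighs at least t^2 / (2 (L - 1));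
   so there are fewer than L of them and adding them reduces to (a).
   If |S| >= L + 2, let D be the degree of v. After deleting v, any D missing triples
   of S - v can be added, so extremality bounds their weight by 3 M t^2. Hence fewer
   than D missing triples meet the set H of vertices of weight at least 3M/D, and
   counting edges gives |H| <= L - 4. The weight rho outside H is then forced below
   2/L by the link of v, and above 2/L by M (1 - 3 rho) <= e_3(H). *)

Require Import Defs.
From mathcomp Require Import all_boot all_order all_algebra.
From mathcomp Require Import all_classical all_reals all_analysis.
From mathcomp Require Import ring lra zify.

Set Implicit Arguments.
Unset Strict Implicit.
Unset Printing Implicit Defensive.

Local Open Scope ring_scope.

(** * Weights of set families *)

Section SetFamilies.
Variable V : finType.
Implicit Types (E : {set {set V}}) (S T e g : {set V}) (i j : V) (r : nat).

Definition del E i : {set {set V}} := [set e in E | i \notin e].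
Definition link E i : {set {set V}} := [set e : {set V} | (i \notin e) && (i |: e \in E)].
Definition ksubs S r : {set {set V}} := [set e : {set V} | (e \subset S) && (#|e| == r)].

Lemma del_link E i j : i != j -> del (link E i) j = link (del E j) i.
Proof.
move=> ij; apply/finset.setP => e; rewrite !inE (eq_sym j i) (negbTE ij) /=.
by case: (i \notin e); case: (j \notin e); rewrite //= ?andbT ?andbF.
Qed.

Lemma linkC E i j : link (link E i) j = link (link E j) i.
Proof.
apply/finset.setP => e; rewrite !inE !negb_or (eq_sym j i) finset.setUCA.
by case: (i != j); case: (i \notin e); case: (j \notin e).
Qed.

Lemma del_ksubs S r i : del (ksubs S r) i = ksubs (S :\ i) r.
Proof.
apply/finset.setP => e; rewrite !inE finset.subsetD1.
by case: (e \subset S); case: (i \notin e); rewrite //= ?andbT ?andbF.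
Qed.

Lemma link_ksubs S r i : i \in S -> link (ksubs S r.+1) i = ksubs (S :\ i) r.
Proof.
move=> iS; apply/finset.setP => e; rewrite !inE finset.subsetD1 finset.subUset.
rewrite finset.sub1set iS /= cardsU1.
by case: (boolP (i \in e)); rewrite /= ?andbF //= add1n eqSS !andbT.
Qed.

Lemma sub_del E1 E2 i : E1 \subset E2 -> del E1 i \subset del E2 i.
Proof.
move=> /fintype.subsetP s; apply/fintype.subsetP => e; rewrite !inE => /andP[/s -> ->] //.
Qed.

Lemma sub_link E1 E2 i : E1 \subset E2 -> link E1 i \subset link E2 i.
Proof.
move=> /fintype.subsetP s; apply/fintype.subsetP => e; rewrite !inE => /andP[-> /s ->] //.
Qed.

Lemma del_sub E i : del E i \subset E.
Proof. by apply/fintype.subsetP => e; rewrite inE => /andP[]. Qed.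

Lemma card_ksubs S r : #|ksubs S r| = 'C(#|S|, r).
Proof. exact: cards_draws. Qed.

Lemma subset_ksubs S T r : S \subset T -> ksubs S r \subset ksubs T r.
Proof.
move=> s; apply/fintype.subsetP => e; rewrite !inE => /andP[/fintype.subset_trans -> //].
Qed.

(** * Weight polynomials, first-order conditions and Maclaurin inequalities *)

Section Weight.
Variable R : realFieldType.
Implicit Types x y : V -> R.

Definition wt E x : R := \sum_(e in E) \prod_(i in e) x i.

(** The polynomial is affine in [x i], so the weight of the link is its partial derivative at [i].
    Iterating this expansion drives every derivative comparison below. *)
Lemma wt_del_link E i x : wt E x = wt (del E i) x + x i * wt (link E i) x.
Proof.
rewrite /wt (bigID (fun e => i \notin e)) /=; congr (_ + _).
  by apply: eq_bigl => e; rewrite inE.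
rewrite mulr_sumr (reindex_onto (fun g => i |: g) (fun e => e :\ i)) /=; last first.
  by move=> e /andP[_]; rewrite negbK => ie; rewrite finset.setD1K.
apply: eq_big => [g|g]; last first.
  move=> /andP[/andP[_ _] /eqP ig].
  have nig : i \notin g by rewrite -ig !inE eqxx.
  by rewrite big_setU1.
rewrite !inE eqxx /= andbT andbC; congr (_ && _).
apply/eqP/idP => [<-|ig]; first by rewrite !inE eqxx.
by rewrite finset.setU1K.
Qed.

Lemma wt_ge0 E x : (forall i, 0 <= x i) -> 0 <= wt E x.
Proof. by move=> x0; apply: sumr_ge0 => e _; apply: prodr_ge0. Qed.

Lemma wtD E1 E2 x : E1 \subset E2 -> wt E2 x = wt E1 x + wt (E2 :\: E1) x.
Proof.
move=> s; rewrite /wt (big_setID E1) /=.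
by rewrite (finset.setIidPr s).
Qed.

Lemma wt_le E1 E2 x : (forall i, 0 <= x i) -> E1 \subset E2 -> wt E1 x <= wt E2 x.
Proof. by move=> x0 s; rewrite (wtD x s) lerDl wt_ge0. Qed.

Lemma wtU E1 E2 x : [disjoint E1 & E2] -> wt (E1 :|: E2) x = wt E1 x + wt E2 x.
Proof. by move=> d; rewrite /wt -bigU //; apply: eq_bigl => e; rewrite !inE. Qed.

Lemma eq_wt E x y : (forall e i, e \in E -> i \in e -> x i = y i) -> wt E x = wt E y.
Proof. by move=> xy; apply: eq_bigr => e eE; apply: eq_bigr => i ie; apply: xy ie. Qed.

Lemma wt_le2 E x y : (forall i, 0 <= x i <= y i) -> wt E x <= wt E y.
Proof. by move=> xy; apply: ler_sum => e _; apply: ler_prod. Qed.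

Lemma wt_set1 e x : wt [set e] x = \prod_(i in e) x i.
Proof. by rewrite /wt big_set1. Qed.

Lemma wt0 x : wt finset.set0 x = 0.
Proof. by rewrite /wt big_set0. Qed.

Lemma wt_scale E r c x : {in E, forall e, #|e| = r} ->
  wt E (fun i => c * x i) = c ^+ r * wt E x.
Proof.
move=> u; rewrite /wt mulr_sumr; apply: eq_bigr => e /u <-.
by rewrite big_split /= prodr_const.
Qed.

Lemma wt_card E : wt E (fun=> 1) = #|E|%:R.
Proof.
rewrite /wt (eq_bigr (fun=> 1)) => [|e _]; first by rewrite sumr_const.
by rewrite big1.
Qed.

Lemma wt_mem E i x : x i * wt (link E i) x = \sum_(e in E | i \in e) \prod_(j in e) x j.
Proof.
apply: (addrI (wt (del E i) x)).
rewrite -wt_del_link /wt (bigID (fun e => i \notin e)) /=; congr (_ + _).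
  by apply: eq_bigl => e; rewrite inE.
by apply: eq_bigl => e; rewrite negbK.
Qed.

(** Euler's identity for homogeneous polynomials: after exchanging the sums, each edge is counted
    once for each of its [r] vertices. *)
Lemma euler E r x : {in E, forall e, #|e| = r} ->
  \sum_i x i * wt (link E i) x = r%:R * wt E x.
Proof.
move=> u; rewrite (eq_bigr _ (fun i _ => wt_mem E i x)).
rewrite (exchange_big_dep (mem E)) /=; last by move=> ? ? _ /andP[].
rewrite /wt mulr_sumr; apply: eq_bigr => e eE.
rewrite (eq_bigl (mem e)); last by move=> i; rewrite /= eE.
by rewrite sumr_const (u _ eE) mulr_natl.
Qed.

Lemma wt_split E i j x : i != j ->
  wt E x = wt (del (del E i) j) x + x i * wt (del (link E i) j) x
    + x j * wt (del (link E j) i) x + x i * x j * wt (link (link E i) j) x.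
Proof.
move=> ij; rewrite (wt_del_link E i) (wt_del_link (del E i) j).
rewrite (wt_del_link (link E i) j) -(del_link E (i := j) (j := i)) 1?eq_sym //; ring.
Qed.

(* Multilinearity makes the variation along the direction e_j - e_i exactly quadratic. *)
Lemma wt_shift E i j x eps : i != j ->
  wt E (fun k => if k == i then x i - eps else if k == j then x j + eps else x k)
  = wt E x + eps * (wt (link E j) x - wt (link E i) x)
    - eps ^+ 2 * wt (link (link E i) j) x.
Proof.
move=> ij; have ji : j != i by rewrite eq_sym.
set y := fun k => _.
have yi : y i = x i - eps by rewrite /y eqxx.
have yj : y j = x j + eps by rewrite /y (negbTE ji) eqxx.
have H (A : {set {set V}}) : (forall e, e \in A -> (i \notin e) && (j \notin e)) -> wt A y = wt A x.
  move=> HA; apply: eq_wt => e k /HA /andP[ie je] ke; rewrite /y.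
  by case: eqP => [ki|_]; [rewrite -ki ke in ie|case: eqP => [kj|//]; rewrite -kj ke in je].
rewrite (wt_split E y ij) (wt_split E x ij) yi yj !H; first last.
- by move=> e; rewrite !inE => /andP[/andP[]]//; case: (i \notin e); rewrite // andbF.
- by move=> e; rewrite !inE => /andP[/andP[-> _] ->].
- by move=> e; rewrite !inE => /andP[/andP[-> _] ->].
- by move=> e; rewrite !inE !negb_or => /and3P[-> /andP[_ ->]].
rewrite (wt_del_link (link E j) i x) (wt_del_link (link E i) j x) (linkC E j i); ring.
Qed.

Definition splx x : Prop := (forall i, 0 <= x i) /\ \sum_i x i = 1.

Lemma splx_shift x i j eps : splx x -> i != j -> - x j <= eps <= x i ->
  splx (fun k => if k == i then x i - eps else if k == j then x j + eps else x k).
Proof.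
move=> [x0 x1] ij /andP[e0 e1]; have ji : j != i by rewrite eq_sym.
split=> [k|].
  by case: eqP => [_|_]; [lra|case: eqP => [_|_]; [lra|exact: x0]].
rewrite -[RHS]x1 (bigD1 i) //= (bigD1 j) //= [in RHS](bigD1 i) //= [in RHS](bigD1 j) //=.
rewrite eqxx (negbTE ji) eqxx.
rewrite (eq_bigr x); first by ring.
by move=> k /andP[/negbTE -> /negbTE ->].
Qed.

Definition maximizer E x : Prop := splx x /\ forall y, splx y -> wt E y <= wt E x.

(** Otherwise a little weight moved from [i] to [j] would raise the value; [0 < x i] makes the move
    possible. *)
Lemma link_mono_maximizer E x i j : maximizer E x -> 0 < x i ->
  wt (link E j) x <= wt (link E i) x.
Proof.
move=> [sx mx] xi; case: (eqVneq i j) => [-> //|ij]; rewrite leNgt; apply/negP => lt.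
set d := wt (link E j) x - wt (link E i) x.
have d0 : 0 < d by rewrite /d subr_gt0.
set C := wt (link (link E i) j) x.
have C0 : 0 <= C by apply: wt_ge0; case: sx.
(* The first bound keeps the shifted point in the simplex. The second keeps the quadratic loss below
   the linear gain, with [C + 1] because [C] may be zero. *)
pose eps := Num.min (x i) (d / (2 * (C + 1))).
have e0 : 0 < eps by rewrite lt_min xi /=; apply: divr_gt0 => //; lra.
have e1 : eps <= x i by rewrite ge_min lexx.
have e2 : eps * (2 * (C + 1)) <= d.
  by rewrite -ler_pdivlMr; [rewrite ge_min lexx orbT|lra].
have ss : splx (fun k => if k == i then x i - eps else if k == j then x j + eps else x k).
  by apply: splx_shift => //; rewrite e1 andbT; case: sx => /(_ j); lra.
have := mx _ ss; rewrite wt_shift // -/d -/C => H.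
have : 0 < eps * (d - eps * C) by apply: mulr_gt0 => //; nra.
nra.
Qed.

(** Derivatives agree on the support, so the common value is their average with weights [x j], which
    [euler] evaluates; vertices of weight zero drop out. *)
Lemma link_maximizer E r x i : {in E, forall e, #|e| = r} -> maximizer E x ->
  0 < x i -> wt (link E i) x = r%:R * wt E x.
Proof.
move=> u mx xi; rewrite -(euler x u); case: (mx) => -[x0 x1] _.
rewrite -[LHS]mul1r -x1 mulr_suml; apply: eq_bigr => j _.
case: (ltrP 0 (x j)) => [xj|xj]; last first.
  by have -> : x j = 0; [apply/eqP; rewrite eq_le xj x0|rewrite !mul0r].
by congr (_ * _); apply/eqP; rewrite eq_le !link_mono_maximizer.
Qed.

Lemma ksubs_wtD S r i x : i \in S ->
  wt (ksubs S r.+1) x = wt (ksubs (S :\ i) r.+1) x + x i * wt (ksubs (S :\ i) r) x.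
Proof. by move=> iS; rewrite (wt_del_link _ i) del_ksubs link_ksubs. Qed.

Lemma ksubs0 S : ksubs S 0 = [set finset.set0].
Proof.
apply/finset.setP => e; rewrite !inE cards_eq0; case: eqP => [->|]; last by rewrite andbF.
by rewrite finset.sub0set.
Qed.

Lemma wt_ksubs0 S x : wt (ksubs S 0) x = 1.
Proof. by rewrite ksubs0 wt_set1 big_set0. Qed.

Lemma ksubs_set0 r : ksubs finset.set0 r.+1 = finset.set0.
Proof.
apply/finset.setP => e; rewrite !inE finset.subset0.
by case: eqP => // ->; rewrite cards0.
Qed.

Lemma set_ind_card (P : {set V} -> Prop) : P finset.set0 ->
  (forall S i, i \in S -> P (S :\ i) -> P S) -> forall S, P S.
Proof.
move=> P0 PS S; move: {2}#|S| (erefl #|S|) => n; elim: n S => [|n IH] S.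
  by move/eqP; rewrite cards_eq0 => /eqP ->.
move=> cS; have /card_gt0P[i iS] : (0 < #|S|)%N by rewrite cS.
apply: (PS _ i) => //; apply: IH; move: cS; rewrite (cardsD1 i) iS; lia.
Qed.

Lemma wt_ksubs1 S x : wt (ksubs S 1) x = \sum_(i in S) x i.
Proof.
elim/set_ind_card: S => [|S i iS IH]; first by rewrite ksubs_set0 wt0 big_set0.
by rewrite (ksubs_wtD _ _ iS) IH wt_ksubs0 mulr1 [RHS](big_setD1 i iS) /= addrC.
Qed.

(** Induction on [S]: with s remaining vertices of total weight sg and a new weight a, the slack of
    the step, multiplied by s, is (sg - s a)^2. *)
Lemma maclaurin2 S x : (forall i, 0 <= x i) ->
  2 * #|S|%:R * wt (ksubs S 2) x <= (#|S|%:R - 1) * (\sum_(i in S) x i) ^+ 2.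
Proof.
move=> x0; elim/set_ind_card: S => [|S i iS].
  by rewrite ksubs_set0 wt0 big_set0 mulr0 expr0n /= mulr0.
rewrite (ksubs_wtD _ _ iS) wt_ksubs1 (big_setD1 i iS) /=.
have -> : #|S| = #|S :\ i|.+1 by rewrite (cardsD1 i S) iS.
have : 0 <= \sum_(k in S :\ i) x k by apply: sumr_ge0.
move: (x0 i).
case: (posnP #|S :\ i|) => [/eqP|].
  rewrite cards_eq0 => /eqP -> _ _ _.
  by rewrite cards0 ksubs_set0 wt0 big_set0 mulr0 !addr0 mulr0 subrr mul0r.
set s := #|S :\ i|; set W := wt _ _; set sg := \sum_(_ in _) _; set a := x i.
rewrite -[s.+1%:R]natr1 -(ltr0n R); move: (s%:R : R) => {}s s0 a0 g0 IH.
have := sqr_ge0 (sg - s * a); nra.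
Qed.

Lemma maclaurin3 S x : (forall i, 0 <= x i) ->
  6 * #|S|%:R ^+ 2 * wt (ksubs S 3) x
    <= (#|S|%:R - 1) * (#|S|%:R - 2) * (\sum_(i in S) x i) ^+ 3.
Proof.
move=> x0; elim/set_ind_card: S => [|S i iS].
  by rewrite ksubs_set0 wt0 big_set0 mulr0 expr0n /= mulr0.
rewrite (ksubs_wtD _ _ iS) (big_setD1 i iS) /=.
have := maclaurin2 (S :\ i) x0.
have -> : #|S| = #|S :\ i|.+1 by rewrite (cardsD1 i S) iS.
have : 0 <= \sum_(k in S :\ i) x k by apply: sumr_ge0.
move: (x0 i).
case: (posnP #|S :\ i|) => [/eqP|].
  rewrite cards_eq0 => /eqP -> _ _ _.
  by rewrite cards0 !ksubs_set0 !wt0 big_set0 mulr0 !addr0 mulr0 subrr !mul0r.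
set s := #|S :\ i|; set W := wt (ksubs _ 3) _; set W2 := wt _ _.
set sg := \sum_(_ in _) _; set a := x i.
rewrite -[s.+1%:R]natr1 -(ltr0n R) => s0.
have : (1 <= s%:R :> R) by rewrite ler1n -(ltr0n R).
move: s0; move: (s%:R : R) => {}s s0 s1 a0 g0 IH2 IH.
(* [K] is exactly the slack of the step, multiplied by [s ^+ 2], once the bounds on pairs and
   triples of [S :\ i] are inserted. *)
have K : 0 <= (sg - s * a) ^+ 2 * (sg * (3 * s + 2) + s * a) * (s - 1).
  apply: mulr_ge0; last by lra.
  by apply: mulr_ge0; [exact: sqr_ge0|nra].
have s2 : 0 < s ^+ 2 by apply: exprn_gt0.
rewrite -(ler_pM2l s2).
have -> : s ^+ 2 * (6 * (s + 1) ^+ 2 * (W + a * W2)) =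
  (s + 1) ^+ 2 * (6 * s ^+ 2 * W) + 3 * (s + 1) ^+ 2 * s * a * (2 * s * W2) by ring.
apply: (@le_trans _ _ ((s + 1) ^+ 2 * ((s - 1) * (s - 2) * sg ^+ 3) +
  3 * (s + 1) ^+ 2 * s * a * ((s - 1) * sg ^+ 2))).
  apply: lerD; apply: ler_wpM2l => //; first by exact: sqr_ge0.
  by apply: mulr_ge0 => //; apply: mulr_ge0; [nra|lra].
rewrite -subr_ge0; apply: (le_trans K); rewrite le_eqVlt; apply/orP; left; apply/eqP; ring.
Qed.

End Weight.

Lemma card_del_linkE E i : #|E| = (#|del E i| + #|link E i|)%N.
Proof.
apply/eqP; rewrite -(eqr_nat rat) natrD -!wt_card (wt_del_link E i) mul1r //.
Qed.

End SetFamilies.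

(** * A clique plus one vertex *)

Section NearClique.
Variables (V : finType) (R : realFieldType).
Implicit Types (E : {set {set V}}) (S T e g : {set V}) (i j : V) (r : nat).
Implicit Types x y : V -> R.

Lemma ksubs_card_eq E S r : E \subset ksubs S r -> {in E, forall e, #|e| = r}.
Proof. by move=> /fintype.subsetP s e /s; rewrite inE => /andP[_ /eqP]. Qed.

Lemma prod_gt0_sub S e x : (forall i, i \in S -> 0 < x i) -> e \subset S ->
  0 < \prod_(i in e) x i.
Proof. by move=> x0 /fintype.subsetP eS; apply: prodr_gt0 => i /eS /x0. Qed.

Lemma wt_gt0 E S r e x : (forall i, i \in S -> 0 < x i) -> E \subset ksubs S r ->
  e \in E -> 0 < wt E x.
Proof.
move=> x0 /fintype.subsetP s eE; rewrite /wt (bigD1 e) //=.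
have pos g : g \in E -> 0 < \prod_(i in g) x i.
  by move=> /s; rewrite inE => /andP[gS _]; apply: prod_gt0_sub gS.
apply: ltr_wpDr; last exact: pos.
by apply: sumr_ge0 => g /andP[/pos /ltW].
Qed.

Lemma wt_lb E S r x mu : 0 <= mu -> (forall i, i \in S -> mu <= x i) ->
  E \subset ksubs S r -> #|E|%:R * mu ^+ r <= wt E x.
Proof.
move=> mu0 mx s; rewrite mulr_natl -sumr_const; apply: ler_sum => e eE.
rewrite -(ksubs_card_eq s eE) -prodr_const; apply: ler_prod => i ie.
rewrite mu0 mx //; move/fintype.subsetP: s => /(_ _ eE); rewrite inE => /andP[+ _].
by move/fintype.subsetP; apply.
Qed.

Lemma wt_ub E S r x nu : (forall i, i \in S -> 0 <= x i <= nu) ->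
  E \subset ksubs S r -> wt E x <= #|E|%:R * nu ^+ r.
Proof.
move=> mx s; rewrite mulr_natl -sumr_const; apply: ler_sum => e eE.
rewrite -(ksubs_card_eq s eE) -prodr_const; apply: ler_prod => i ie.
rewrite mx //; move/fintype.subsetP: s => /(_ _ eE); rewrite inE => /andP[+ _].
by move/fintype.subsetP; apply.
Qed.

Lemma exists_argmin S x : S != finset.set0 ->
  exists2 u, u \in S & forall i, i \in S -> x u <= x i.
Proof.
by case/finset.set0Pn => v vS; case: (arg_minP x vS) => u uS um; exists u.
Qed.

Lemma setD1C S i j : S :\ i :\ j = S :\ j :\ i.
Proof. by apply/finset.setP => k; rewrite !inE; case: (k != i); case: (k != j). Qed.

Lemma cardsD1_in S i : i \in S -> #|S| = #|S :\ i|.+1.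
Proof. by move=> iS; rewrite (cardsD1 i S) iS. Qed.

Lemma del_near_clique E S v r : E \subset ksubs S r -> ksubs (S :\ v) r \subset E ->
  del E v = ksubs (S :\ v) r.
Proof.
move=> ES clE; apply/eqP; rewrite finset.eqEsubset; apply/andP; split.
  by rewrite -del_ksubs sub_del.
apply/fintype.subsetP => e eT; rewrite inE (fintype.subsetP clE) //=.
by move: eT; rewrite inE finset.subsetD1 => /andP[/andP[]].
Qed.

Section Maximizer.
Variables (p : nat) (E : {set {set V}}) (S : {set V}) (v : V) (x : V -> R).
Hypotheses (ES : E \subset ksubs S p.+3) (vS : v \in S)
  (clE : ksubs (S :\ v) p.+3 \subset E)
  (xS : forall i, i \in S -> 0 < x i) (mx : maximizer E x)
  (leL : (p.+3 <= #|S :\ v|)%N).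
Let T := S :\ v.
Let B := link E v.
Let t := x v.

Let x0 i : 0 <= x i. Proof. by case: mx => -[]. Qed.
Let TS i : i \in T -> i \in S. Proof. by rewrite !inE => /andP[]. Qed.
Let Tv i : i \in T -> i != v. Proof. by rewrite !inE => /andP[]. Qed.
Let xT i : i \in T -> 0 < x i. Proof. by move/TS/xS. Qed.

Let kkt i j : i \in S -> j \in S -> wt (link E i) x = wt (link E j) x.
Proof. by move=> iS jS; apply/eqP; rewrite eq_le !link_mono_maximizer ?xS. Qed.

Let BT : B \subset ksubs T p.+2.
Proof. by rewrite -(link_ksubs _ vS) sub_link. Qed.

Let delE : del E v = ksubs T p.+3 := del_near_clique ES clE.

Let linkT u : u \in T ->
  wt (link E u) x = wt (ksubs (T :\ u) p.+2) x + t * wt (link B u) x.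
Proof.
move=> uT; rewrite (wt_del_link (link E u) v) (del_link _ (Tv uT)) delE.
by rewrite link_ksubs // linkC.
Qed.

(** Expand the equal derivatives at [i] and [j] along [v], then along the other of the two vertices.
    The clique terms avoiding both cancel, and the terms through the other vertex share a factor. *)
Let link_diff i j : i \in T -> j \in T -> i != j ->
  (x i - x j) * (wt (ksubs (T :\ i :\ j) p.+1) x + t * wt (link (link B i) j) x)
  = t * (wt (del (link B i) j) x - wt (del (link B j) i) x).
Proof.
move=> iT jT ij; have := kkt (TS iT) (TS jT); rewrite !linkT //.
have jTi : j \in T :\ i by rewrite in_setD1 eq_sym ij.
have iTj : i \in T :\ j by rewrite in_setD1 ij.
rewrite (ksubs_wtD _ _ jTi) (ksubs_wtD _ _ iTj).
rewrite (wt_del_link (link B i) j) (wt_del_link (link B j) i) (linkC B j i).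
rewrite (setD1C T j i) => H.
lra.
Qed.

Let linkB_sub u : u \in T -> link B u \subset ksubs (T :\ u) p.+1.
Proof. by move=> uT; rewrite -link_ksubs // sub_link. Qed.

(** In [link_diff] the factor on the left is at least [Q] and the difference on the right at most
    [Q], since the links of [B] lie in complete graphs; [Q] is positive because [T] has at least
    [p.+3] vertices. *)
Let vertex_gap i j : i \in T -> j \in T -> x i - x j <= t.
Proof.
move=> iT jT; case: (eqVneq i j) => [->|ij]; first by rewrite subrr x0.
set Q := wt (ksubs (T :\ i :\ j) p.+1) x.
have Q0 : 0 < Q.
  have : (0 < #|ksubs (T :\ i :\ j) p.+1|)%N.
    rewrite card_ksubs bin_gt0; move: leL; rewrite -/T (cardsD1_in iT).
    by rewrite (@cardsD1_in (T :\ i) j) // in_setD1 eq_sym ij.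
  case/card_gt0P => e; apply: wt_gt0 (fintype.subxx _) => k.
  by rewrite in_setD1 => /andP[_]; rewrite in_setD1 => /andP[_ /xT].
case: (lerP (x i) (x j)) => [|ji]; first by have := x0 v; rewrite -/t; lra.
have H := link_diff iT jT ij; rewrite -/Q in H.
have c0 : 0 <= t * wt (link (link B i) j) x by apply: mulr_ge0; rewrite ?wt_ge0 ?x0.
have d0 : 0 <= wt (del (link B j) i) x by rewrite wt_ge0.
have dQ : wt (del (link B i) j) x <= Q.
  by apply: wt_le => //; rewrite -del_ksubs sub_del // linkB_sub.
have t0 : 0 <= t by exact: x0.
rewrite -(ler_pM2r Q0); apply: (@le_trans _ _ (t * (wt (del (link B i) j) x - wt (del (link B j) i) x))).
  rewrite -H ler_pM2l ?subr_gt0 //; lra.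
by apply: ler_wpM2l => //; lra.
Qed.

(** A set [e] missing from [B] must avoid [u]. For [i] in [e] it makes the right side of [link_diff]
    at [i] and [u] negative, against the minimality of [x u]. This rules out a complete [link B u],
    since the edge bound does not allow a complete [B]. *)
Let full_link u : u \in T -> (forall i, i \in T -> x u <= x i) ->
  link B u = ksubs (T :\ u) p.+1 -> B = ksubs T p.+2.
Proof.
move=> uT umin Bu; apply/eqP; rewrite finset.eqEsubset BT /=; apply/fintype.subsetP => e eT.
have [eTs ec] : e \subset T /\ #|e| = p.+2 by move: eT; rewrite inE => /andP[-> /eqP].
case: (boolP (u \in e)) => ue.
  have : e :\ u \in link B u.
    by rewrite Bu inE finset.setSD //=; move: ec; rewrite (cardsD1_in ue) => -[->].
  by rewrite inE finset.setD1K // => /andP[].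
have /card_gt0P[i ie] : (0 < #|e|)%N by rewrite ec.
have iT : i \in T by exact: (fintype.subsetP eTs).
have iu : i != u by apply: contraNneq ue => <-.
have H := link_diff iT uT iu.
rewrite Bu del_ksubs (setD1C T u i) in H.
set Dr := ksubs _ _ in H *; set De := del (link B i) u in H *.
have DD : De \subset Dr by rewrite /De /Dr -del_ksubs sub_del // linkB_sub.
have : wt (Dr :\: De) x <= 0.
  have t0 : 0 < t by exact: xS.
  have := wtD x DD; move: (wt (Dr :\: De) x) => w Hw.
  have : 0 <= t * (wt De x - wt Dr x).
    rewrite -H; apply: mulr_ge0; first by rewrite subr_ge0 umin.
    by rewrite addr_ge0 ?mulr_ge0 ?wt_ge0 ?(ltW t0).
  by rewrite pmulr_rge0 // Hw; lra.
have eD : e :\ i \in Dr.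
  rewrite inE finset.subsetD1 finset.setSD //= !inE negb_and ue orbT /=.
  by move: ec; rewrite (cardsD1_in ie) => -[->].
case: (boolP (e :\ i \in De)) => [|neD].
  by rewrite 2!finset.in_set finset.setD1K // => /andP[/andP[]].
rewrite leNgt (wt_gt0 (S := T) (r := p.+1) (e := e :\ i) xT) //; last by rewrite inE neD.
apply: (fintype.subset_trans (finset.subsetDl _ _)); apply: subset_ksubs.
by apply/fintype.subsetP => k; rewrite !inE => /and3P[].
Qed.

(** Here [p] is r - 3, and the numerical hypothesis is the upper bound on m after subtracting the
    edges of the clique. *)
Lemma near_clique_maximizer :
  (#|link E v| + (2 ^ p - 1) * ('C(#|S :\ v|.-1, p.+1) - 1)
     <= 'C(#|S :\ v|.-1, p.+2))%N ->
  exists y, [/\ splx y, y v = 0 & wt E y = wt E x].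
Proof.
rewrite -/T -/B => hB.
have [|u uT umin] := @exists_argmin T x.
  by rewrite -cards_eq0 -lt0n (leq_trans _ leL).
have cT := cardsD1_in uT; rewrite cT /= in hB.
have t0 : 0 < t := xS vS.
have uv := Tv uT.
have cB : (#|link B u| <= 'C(#|T :\ u|, p.+1))%N.
  by rewrite -card_ksubs subset_leq_card // linkB_sub.
have C0 : (0 < 'C(#|T :\ u|, p.+1))%N by rewrite bin_gt0; move: leL; rewrite -/T cT; lia.
case: (posnP #|link B u|) => [/eqP|b0].
  rewrite cards_eq0 => /eqP lB0.
  (* In [wt_shift] the linear term vanishes because the derivatives at [u] and [v] agree, the
     quadratic one because no edge contains both. *)
  exists (fun k => if k == v then x v - t else if k == u then x u + t else x k).
  split; [|by rewrite eqxx subrr|].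
    apply: splx_shift; [by case: mx|by rewrite eq_sym|].
    by rewrite lexx andbT (le_trans _ (ltW t0)) // oppr_le0.
  by rewrite wt_shift 1?eq_sym // (kkt (TS uT) vS) subrr mulr0 addr0 lB0 wt0 mulr0 subr0.
case: (ltngtP #|link B u| 'C(#|T :\ u|, p.+1)) cB => // [bC|bC] _; last first.
  have : B = ksubs T p.+2.
    apply: (full_link uT umin); apply/eqP.
    by rewrite finset.eqEcard linkB_sub // card_ksubs bC leqnn.
  move/(congr1 (fun A : {set {set V}} => #|A|)); rewrite card_ksubs cT binS => cBT; exfalso;
  by move: hB C0; rewrite cBT; move: ((2 ^ p - 1) * _)%N => q; lia.
exfalso.
set N := ksubs (T :\ u) p.+2 :\: del B u.
have dsub : del B u \subset ksubs (T :\ u) p.+2 by rewrite -del_ksubs sub_del.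
(* Let b be the size of [link B u] and C that of the complete graph containing it. The hypothesis
   leaves at least b + (2^p - 1)(C - 1) sets in [N], and b <= C - 1 because the link is not
   complete. *)
have cN : (2 ^ p * #|link B u| <= #|N|)%N.
  have := cardsDS dsub; rewrite -/N card_ksubs => ->.
  move: hB; rewrite (card_del_linkE B u).
  have : (0 < 2 ^ p)%N by rewrite expn_gt0.
  have : ((2 ^ p - 1) * #|link B u| <= (2 ^ p - 1) * ('C(#|T :\ u|, p.+1) - 1))%N.
    by rewrite leq_mul2l; apply/orP; right; move: bC; lia.
  rewrite [((2 ^ p - 1) * #|link B u|)%N]mulnBl mul1n; move: (2 ^ p)%N ((2 ^ p - 1) * _)%N (2 ^ p * _)%N => d c a.
  by move: ('C(_, p.+2)) => f; lia.
set mu := x u; have mu0 : 0 < mu by exact: xT.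
have ub i : i \in T -> 0 <= x i <= mu + t.
  by move=> iT; rewrite x0 /=; have := vertex_gap iT uT; rewrite -/mu; lra.
have key : (mu - t) * wt (link B u) x = wt N x.
  have := kkt (TS uT) vS; rewrite linkT // (wt_del_link (link E v) u) -/B.
  by rewrite (wtD x dsub) -/N -/mu; lra.
have lN : #|N|%:R * mu ^+ p.+2 <= wt N x.
  apply: (@wt_lb _ T) => //; first exact: ltW.
  apply: (fintype.subset_trans (finset.subsetDl _ _)); apply: subset_ksubs.
  by rewrite finset.subD1set.
have uB : wt (link B u) x <= #|link B u|%:R * (mu + t) ^+ p.+1.
  apply: (@wt_ub _ T) => //; apply: (fintype.subset_trans (linkB_sub uT)).
  by apply: subset_ksubs; rewrite finset.subD1set.
have lN2 : (2 ^ p * #|link B u|)%:R * mu ^+ p.+2 <= wt N x.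
  by apply: le_trans lN; rewrite ler_pM2r ?exprn_gt0 // ler_nat.
have b0R : 0 < #|link B u|%:R :> R by rewrite ltr0n.
have pos : 0 < (2 ^ p * #|link B u|)%:R * mu ^+ p.+2.
  by rewrite mulr_gt0 ?exprn_gt0 // ltr0n muln_gt0 expn_gt0 b0.
have w0 : 0 <= wt (link B u) x by rewrite wt_ge0.
have mt : t < mu.
  rewrite ltNge; apply/negP => mt; have : (mu - t) * wt (link B u) x <= 0.
    by rewrite mulr_le0_ge0 // subr_le0.
  by rewrite key; lra.
have : (mu - t) * wt (link B u) x <= (mu - t) * (#|link B u|%:R * (mu + t) ^+ p.+1).
  by rewrite ler_pM2l ?subr_gt0.
rewrite key => /(le_trans lN2); rewrite natrM natrX => H.
have : #|link B u|%:R * (2 ^+ p * mu ^+ p.+2) <= #|link B u|%:R * ((mu - t) * (mu + t) ^+ p.+1).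
  by apply: le_trans (le_trans H _); rewrite le_eqVlt; apply/orP; left; apply/eqP; ring.
rewrite ler_pM2l // leNgt => /negP; apply.
(* One factor mu + t is paired with mu - t, giving mu^2 - t^2 < mu^2; the other [p] factors are at
   most 2 mu since t < mu. *)
apply: (@le_lt_trans _ _ ((mu - t) * (mu + t) * (2 * mu) ^+ p)).
  rewrite exprS mulrA ler_wpM2l //; first by apply: mulr_ge0; lra.
  by apply: lerXn2r; rewrite ?nnegrE; lra.
rewrite exprMn !exprS !mulrA.
have : 0 < 2 ^+ p * mu ^+ p by rewrite mulr_gt0 // exprn_gt0.
have -> : (mu - t) * (mu + t) * 2 ^+ p * mu ^+ p = (mu - t) * (mu + t) * (2 ^+ p * mu ^+ p) by ring.
have -> : 2 ^+ p * mu * mu * mu ^+ p = mu * mu * (2 ^+ p * mu ^+ p) by ring.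
by move=> q; rewrite ltr_pM2r //; nra.
Qed.

End Maximizer.
End NearClique.

(** * Transfer to Lagrangians, and part (a) *)

Section Lagrangian.
Variable R : realType.

Lemma splx_gt0 n (y : 'I_n -> R) : splx y -> (0 < n)%N.
Proof. by case: n y => // y [_] /esym/eqP; rewrite big_ord0 oner_eq0. Qed.

Lemma lagrangian_maximizer r n (G : uniform_graph r n) : (0 < n)%N ->
  exists2 x, maximizer (edges G) x & wt (edges G) x = lagrangian R G.
Proof.
move=> /(lagrangian_max R G)[x [x0 x1] [xG mx]].
exists (x ord0); last exact: xG.
split=> // y [y0 y1]; have := mx (\row_i y i); rewrite -xG => H.
have -> : wt (edges G) y = weight G (\row_i y i).
  by apply: eq_bigr => e _; apply: eq_bigr => i _; rewrite mxE.
apply: H; split=> [i|]; first by rewrite mxE.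
by rewrite -y1; apply: eq_bigr => i _; rewrite mxE.
Qed.

Lemma exists_maximizer r n (E : {set {set 'I_n}}) : (0 < n)%N ->
  {in E, forall e : {set 'I_n}, #|e| = r} -> exists x : 'I_n -> R, maximizer E x.
Proof.
by move=> n0 u; have [x mx _] := lagrangian_maximizer (UniformGraph u) n0; exists x.
Qed.

(** The mass that [z] lacks is put on one vertex, which can only increase the weight. *)
Lemma wt_le_lagrangian r n (G : uniform_graph r n) (z : 'I_n -> R) : (0 < n)%N ->
  (forall i, 0 <= z i) -> \sum_i z i <= 1 -> wt (edges G) z <= lagrangian R G.
Proof.
move=> n0 z0 z1; have [x [_ mx] <-] := lagrangian_maximizer G n0.
have [k0 _] : exists k : 'I_n, true by exists (Ordinal n0).
set s := \sum_i z i in z1.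
pose y k := z k + (1 - s) * (k == k0)%:R.
have le i : z i <= y i by rewrite lerDl mulr_ge0 ?ler0n // subr_ge0.
apply: (@le_trans _ _ (wt (edges G) y)); first by apply: wt_le2 => i; rewrite z0 le.
apply: mx; split=> [i|]; first exact: le_trans (z0 i) (le i).
rewrite big_split /= -/s (bigD1 k0) //= eqxx mulr1 big1 ?addr0; first by ring.
by move=> i /negbTE ->; rewrite mulr0.
Qed.

(** A zero weight in [S] confines the polynomial to [#|S :\ v|] vertices; if there is none,
    [near_clique_maximizer] gives another maximizer that vanishes at [v]. The bound [c] is abstract
    because it is a Lagrangian in (a) and [complete3] in (b). *)
Lemma near_clique_bound n p (E : {set {set 'I_n}}) S v (c : R) :
  E \subset ksubs S p.+3 -> v \in S -> ksubs (S :\ v) p.+3 \subset E ->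
  (p.+3 <= #|S :\ v|)%N ->
  (#|link E v| + (2 ^ p - 1) * ('C(#|S :\ v|.-1, p.+1) - 1)
     <= 'C(#|S :\ v|.-1, p.+2))%N ->
  (forall (T : {set 'I_n}) (y : 'I_n -> R), (#|T| <= #|S :\ v|)%N -> splx y ->
     wt (ksubs T p.+3) y <= c) ->
  forall y, splx y -> wt E y <= c.
Proof.
move=> ES vS clE leL hB hc y sy.
have [x mx] := exists_maximizer (splx_gt0 sy) (ksubs_card_eq ES).
have [sx xm] := mx.
suff: wt E x <= c by apply: le_trans; exact: xm.
have zero z i : splx z -> i \in S -> z i = 0 -> wt E z <= c.
  move=> sz iS zi; rewrite (wt_del_link E i) zi mul0r addr0.
  apply: le_trans (hc (S :\ i) z _ sz); last first.
    by move: (cardsD1_in iS); rewrite (cardsD1_in vS) => -[->].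
  by apply: wt_le; [case: sz|rewrite -del_ksubs sub_del].
case: (boolP [forall i in S, 0 < x i]) => [/forall_inP xS|].
  have [z [sz zv <-]] := near_clique_maximizer ES vS clE xS mx leL hB.
  exact: (zero _ _ sz vS zv).
rewrite negb_forall_in => /exists_inP[i iS xi]; apply: (zero _ _ sx iS).
by apply/eqP; rewrite eq_le (sx.1 i) andbT leNgt.
Qed.

(** [lift v] identifies the smaller vertex set with the vertices other than [v], which makes
    Lagrangians on different vertex sets comparable. *)
Lemma wt_ksubs_lift L r (v : 'I_L.+1) (x : 'I_L.+1 -> R) :
  wt (ksubs ([set: 'I_L.+1]%SET :\ v) r) x = wt (ksubs [set: 'I_L]%SET r) (x \o lift v).
Proof.
pose h (e : {set 'I_L}) : {set 'I_L.+1} := [set lift v i | i in e]%SET.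
pose g (f : {set 'I_L.+1}) : {set 'I_L} := [set i | lift v i \in f]%SET.
have gh e : g (h e) = e.
  apply/finset.setP => i; rewrite inE; apply/imsetP/idP => [[j je /lift_inj -> //]|ie].
  by exists i.
rewrite /wt (reindex_onto h g) /=.
  apply: eq_big => [e|e].
    rewrite gh eqxx andbT !inE finset.subsetT card_imset; last exact: lift_inj.
    rewrite finset.subsetD1 finset.subsetT /=.
    case: (boolP (v \in h e)) => //= /imsetP[i _ vi].
    by move: (neq_lift v i); rewrite -vi eqxx.
  by move=> _; rewrite big_imset //= => i j _ _; exact: lift_inj.
move=> f; rewrite inE finset.subsetD1 => /andP[/andP[_ vf] _].
apply/finset.setP => k; apply/imsetP/idP => [[i]|kf]; first by rewrite inE => ? ->.
case: (unliftP v k) kf => [i ->|->]; last by rewrite (negbTE vf).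
by move=> ik; exists i => //; rewrite inE.
Qed.

Lemma edges_complete r n : edges (complete_graph r n) = ksubs [set: 'I_n]%SET r.
Proof. by apply/finset.setP => e; rewrite !inE finset.subsetT. Qed.

Lemma lagrangian_complete_ge L r (T : {set 'I_L.+1}) (y : 'I_L.+1 -> R) : (0 < L)%N ->
  (#|T| <= L)%N -> splx y -> wt (ksubs T r) y <= lagrangian R (complete_graph r L).
Proof.
move=> L0 cT [y0 y1].
have /subsetPn[i _ iT] : ~~ ([set: 'I_L.+1]%SET \subset T).
  by apply/negP => /subset_leq_card; rewrite cardsT card_ord; lia.
apply: (@le_trans _ _ (wt (ksubs ([set: 'I_L.+1]%SET :\ i) r) y)).
  by apply: wt_le => //; apply: subset_ksubs; rewrite finset.subsetD1 finset.subsetT.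
rewrite wt_ksubs_lift -edges_complete; apply: wt_le_lagrangian => //=.
by rewrite -y1 (bigD1_ord i) //= lerDr.
Qed.

Lemma lagrangian_clique_ge L r (G : uniform_graph r L.+1) v : (0 < L)%N ->
  ksubs ([set: 'I_L.+1]%SET :\ v) r \subset edges G ->
  lagrangian R (complete_graph r L) <= lagrangian R G.
Proof.
move=> L0 sG; have [z [[z0 z1] _] <-] := lagrangian_maximizer (complete_graph r L) L0.
pose x k := if unlift v k is Some j then z j else 0.
have xv : x v = 0 by rewrite /x unlift_none.
have xl j : x (lift v j) = z j by rewrite /x liftK.
have x0 i : 0 <= x i by rewrite /x; case: unlift.
have -> : wt (edges (complete_graph r L)) z = wt (ksubs ([set: 'I_L.+1]%SET :\ v) r) x.
  rewrite wt_ksubs_lift edges_complete; apply: eq_bigr => e _.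
  by apply: eq_bigr => i _; rewrite /= xl.
apply: (@le_trans _ _ (wt (edges G) x)); first exact: wt_le.
apply: wt_le_lagrangian => //; rewrite (bigD1_ord v) //= xv add0r.
by rewrite (eq_bigr z) ?z1 // => j _; rewrite xl.
Qed.

Lemma lagrangian_near_clique (r m l : nat) (G : uniform_graph r l) :
  (3 <= r)%N -> (0 < m)%N -> (0 < l)%N ->
  m%:Z <= 'C(l - 1, r)%:Z + 'C(l - 2, r - 1)%:Z
          - (2 ^+ (r - 3) - 1) * ('C(l - 2, r - 2)%:Z - 1) ->
  #|edges G| = m ->
  has_clique G (l - 1) ->
  lagrangian R G = lagrangian R (complete_graph r (l - 1)).
Proof.
case: l G => // L G; case: r G => [|[|[|p]]] // G _ m0 _.
have -> : (L.+1 - 1 = L)%N by lia.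
have -> : (L.+1 - 2 = L.-1)%N by lia.
have -> : (p.+3 - 1 = p.+2)%N by lia.
have -> : (p.+3 - 2 = p.+1)%N by lia.
have -> : (p.+3 - 3 = p)%N by lia.
move=> hm cG [K cK clK].
have pE : ((2 ^+ p - 1 : int) = (2 ^ p - 1)%N%:Z).
  by rewrite -subzn ?expn_gt0 // -natrX natz.
rewrite pE in hm.
(* If l - 1 < r, the existence of an edge forces l = r, and then the upper bound on m evaluates to
   0. *)
have leL : (p.+3 <= L)%N.
  rewrite leqNgt; apply/negP => Lp.
  have /card_gt0P[e eG] : (0 < #|edges G|)%N by rewrite cG.
  have := max_card (mem e); rewrite (edges_card eG) card_ord => Lp'.
  have LE : L = p.+2 by lia.
  by move: hm m0; rewrite LE /= binn !bin_small //; lia.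
have L0 : (0 < L)%N by lia.
have /cards1P[v vK] : #|~: K| == 1%N.
  by have := cardsC K; rewrite cK card_ord; lia.
have KE : K = [set: 'I_L.+1]%SET :\ v by rewrite finset.setTD -vK finset.setCK.
have sK : ksubs ([set: 'I_L.+1]%SET :\ v) p.+3 \subset edges G.
  apply/fintype.subsetP => e; rewrite -KE inE => /andP[eK /eqP ce]; exact: clK.
have cT : #|[set: 'I_L.+1]%SET :\ v| = L by rewrite -KE.
apply/eqP; rewrite eq_le (lagrangian_clique_ge L0 sK) andbT.
have [x [sx _] <-] := lagrangian_maximizer G (ltn0Sn L).
have Gs : edges G \subset ksubs [set: 'I_L.+1]%SET p.+3.
  by apply/fintype.subsetP => e /edges_card; rewrite inE finset.subsetT => ->; rewrite eqxx.
apply: (near_clique_bound Gs (finset.in_setT v) sK) => //; rewrite cT //; last first.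
  by move=> T y cTy; apply: lagrangian_complete_ge.
have := card_del_linkE (edges G) v; rewrite (del_near_clique Gs sK) card_ksubs cT cG.
have : (0 < 'C(L.-1, p.+1))%N by rewrite bin_gt0; lia.
move: hm; set a := 'C(L, _); set b := 'C(_, p.+2); set d := 'C(_, _).
set q := #|link _ _|; move: (2 ^ p - 1)%N => s H d0 mE.
have : (s%:Z * (d%:Z - 1) = (s * (d - 1))%N%:Z) by rewrite PoszM -subzn.
by move=> sd; rewrite sd in H; lia.
Qed.

End Lagrangian.

(** * 3-graphs with at least L + 1 supporting vertices *)

Section TripleBounds.
Variables (V : finType) (R : realFieldType).
Implicit Types (E A : {set {set V}}) (S T e f : {set V}) (x : V -> R).

(* C(L,3) / L^3, the Lagrangian of the complete 3-graph on L vertices. *)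
Definition complete3 (L : nat) : R :=
  (L%:R - 1) * (L%:R - 2) / (6 * L%:R ^+ 2).

Lemma complete3_gt0 L : (3 <= L)%N -> 0 < complete3 L.
Proof.
move=> L3; have : (3%:R <= L%:R :> R) by rewrite ler_nat.
rewrite /complete3 => {}L3; apply: divr_gt0; first by apply: mulr_gt0; lra.
by apply: mulr_gt0 => //; apply: exprn_gt0; lra.
Qed.

Lemma complete3M L : (3 <= L)%N -> 6 * L%:R ^+ 2 * complete3 L = (L%:R - 1) * (L%:R - 2).
Proof.
move=> L3; have : (3%:R <= L%:R :> R) by rewrite ler_nat.
by move=> {}L3; rewrite /complete3; field; lra.
Qed.

Lemma ksubs3_bound S x : (forall i, 0 <= x i) -> \sum_(i in S) x i <= 1 ->
  6 * #|S|%:R ^+ 2 * wt (ksubs S 3) x <= (#|S|%:R - 1) * (#|S|%:R - 2).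
Proof.
move=> x0 x1; apply: (le_trans (maclaurin3 S x0)).
rewrite -[leRHS]mulr1; apply: ler_wpM2l.
  case: #|S| => [|[|s]]; [lra|lra|].
  by rewrite -[s.+2%:R]natr1 -[s.+1%:R]natr1; apply: mulr_ge0; have := ler0n R s; lra.
by apply: exprn_ile1 => //; apply: sumr_ge0.
Qed.

Lemma ksubs3_le_complete3 L S x : (3 <= L)%N -> (#|S| <= L)%N ->
  (forall i, 0 <= x i) -> \sum_(i in S) x i <= 1 -> wt (ksubs S 3) x <= complete3 L.
Proof.
move=> L3 SL x0 x1; case: (posnP #|S|) => [/eqP|S0].
  by rewrite cards_eq0 => /eqP ->; rewrite ksubs_set0 wt0 ltW ?complete3_gt0.
have := ksubs3_bound x0 x1; move: (wt _ _) => w; have := complete3M L3.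
move: L3 SL S0 (complete3 L); rewrite -(ler_nat R) -(ler_nat R) -(ltr0n R).
move: #|S| => s; rewrite ltr0n -(ler_nat R).
move: (s%:R : R) (L%:R : R) => {}s {}L L3 sL s1 K HK Hw.
have sL2 : 0 < 6 * s ^+ 2 * L ^+ 2 by rewrite !mulr_gt0 ?exprn_gt0; lra.
rewrite -(ler_pM2l sL2); apply: (@le_trans _ _ (L ^+ 2 * ((s - 1) * (s - 2)))).
  have -> : 6 * s ^+ 2 * L ^+ 2 * w = L ^+ 2 * (6 * s ^+ 2 * w) by ring.
  by apply: ler_wpM2l => //; exact: sqr_ge0.
have -> : 6 * s ^+ 2 * L ^+ 2 * K = s ^+ 2 * ((L - 1) * (L - 2)) by rewrite -HK; ring.
rewrite -subr_ge0.
have -> : s ^+ 2 * ((L - 1) * (L - 2)) - L ^+ 2 * ((s - 1) * (s - 2)) =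
  (L - s) * (3 * s * L - 2 * L - 2 * s) by ring.
by apply: mulr_ge0; nra.
Qed.

Lemma complete3_lt L : (3 <= L)%N -> complete3 L < complete3 L.+1.
Proof.
move=> L3; rewrite /complete3 -[L.+1%:R]natr1; move: L3; rewrite -(ler_nat R).
move: (L%:R : R) => {}L L3.
rewrite ltr_pdivrMr; last by apply: mulr_gt0 => //; apply: exprn_gt0; lra.
rewrite mulrAC ltr_pdivlMr; last by apply: mulr_gt0 => //; apply: exprn_gt0; lra.
rewrite -subr_gt0.
have -> : (L + 1 - 1) * (L + 1 - 2) * (6 * L ^+ 2) - (L - 1) * (L - 2) * (6 * (L + 1) ^+ 2)
  = 6 * ((L - 1) * (3 * L + 2)) by ring.
by apply: mulr_gt0 => //; apply: mulr_gt0; lra.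
Qed.

(** Convexity of C(n, 3): its increments C(n, 2) grow with n. *)
Lemma bin3_shift a b j : (b <= a)%N -> ('C(a, 3) + 'C(b + j, 3) <= 'C(a + j, 3) + 'C(b, 3))%N.
Proof.
move=> ba; elim: j => [|j IH]; first by rewrite !addn0.
rewrite !addnS !binS; have : ('C(b + j, 2) <= 'C(a + j, 2))%N by apply: leq_bin2l; lia.
by lia.
Qed.

(** Here [k] counts the vertices of S other than v, [h] the heavy ones, [a] and [c] the edges
    avoiding and containing v, [b] the missing triples with a heavy vertex. If h >= L - 3, convexity
    gives C(L+1, 3) - 4 <= a + b < N, against N <= C(L+1, 3) - 2 (L - 1). *)
Lemma heavy_count L k h N a b c : (4 <= L)%N -> (L.+1 <= k)%N -> N = (a + c)%N ->
  ('C(k, 3) <= a + b + 'C(k - h, 3))%N -> (b < c)%N ->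
  (N + 2 * (L - 1) <= 'C(L.+1, 3))%N -> (h + 4 <= L)%N.
Proof.
move=> L4 kL -> H bc leE; rewrite leqNgt; apply/negP => hL.
have : ('C(k - h, 3) <= 'C(4 + (k - L.+1), 3))%N by apply: leq_bin2l; lia.
have l4 : (4 <= L.+1)%N by lia.
have := bin3_shift (k - L.+1) l4; rewrite subnKC //.
have -> : 'C(4, 3) = 4%N by [].
by move: H leE L4; lia.
Qed.

Lemma prod3_lb f x t i : 0 <= t -> (forall j, j \in f -> t <= x j) -> #|f| = 3%N ->
  i \in f -> t ^+ 2 * x i <= \prod_(j in f) x j.
Proof.
move=> t0 tx cf fi; rewrite (big_setD1 i fi) /= mulrC.
apply: ler_wpM2l; first exact: le_trans (tx _ fi).
have -> : 2%N = #|f :\ i| by move: cf; rewrite (cardsD1_in fi) => -[].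
rewrite -prodr_const; apply: ler_prod => j; rewrite in_setD1 => /andP[_ /tx ->].
by rewrite t0.
Qed.

(** [h] and [l] stand for [#|heavy|] and [L], and [a] for the weight of [heavy]. The pair inequality
    forces q = a l above l - 2. The triple inequality, pushed to the extreme values h = l - 4 and q
    = l - 2, then gives (l - 1)(l - 4)^2 <= (l - 5)(l - 2)^2, which fails by 4. *)
Lemma large_support_numeric (h l M a : R) : 2 <= h -> h + 4 <= l ->
  0 <= a -> a <= 1 -> (l - 1) * (l - 2) <= 6 * l ^+ 2 * M ->
  6 * h * M * (1 - 2 / l) <= (h - 1) * a ^+ 2 ->
  6 * h ^+ 2 * M * (3 * a - 2) <= (h - 1) * (h - 2) * a ^+ 3 -> False.
Proof.
move=> h2 hl a0 a1 HM P T.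
have l0 : 0 < l by lra.
have l2 : 0 < l - 2 by lra.
have h0 : 0 < h by lra.
pose q := a * l.
have q0 : 0 <= q by rewrite mulr_ge0 // ltW.
have ql : q <= l by rewrite /q ler_piMl // ltW.
have P' : 6 * l ^+ 2 * M * (h * (l - 2)) <= (h - 1) * l * q ^+ 2.
  have l3 : 0 <= l ^+ 3 by rewrite exprn_ge0 // ltW.
  have := ler_wpM2r l3 P; apply: etrans; congr (_ <= _); last by rewrite /q; ring.
  by field; rewrite gt_eqF.
have {P'} P' : (l - 1) * h * (l - 2) ^+ 2 <= (h - 1) * l * q ^+ 2.
  apply: le_trans P'.
  have -> : (l - 1) * h * (l - 2) ^+ 2 = (l - 1) * (l - 2) * (h * (l - 2)) by ring.
  by rewrite ler_wpM2r // mulr_ge0 // ltW.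
have q2 : (l - 2) ^+ 2 < q ^+ 2.
  have lh : 0 < (l - 1) * h by apply: mulr_gt0 => //; lra.
  have pos : 0 < (l - 1) * h * (l - 2) ^+ 2 by rewrite mulr_gt0 // exprn_gt0.
  rewrite -(ltr_pM2l lh); apply: (le_lt_trans P').
  have qp : 0 < q ^+ 2.
    rewrite lt0r sqr_ge0 andbT; apply/eqP => qz.
    by move: P'; rewrite qz mulr0; lra.
  by rewrite ltr_pM2r //; lra.
have {q2} q2 : l - 2 < q by rewrite -(ltr_pXn2r (n := 2)) // nnegrE ltW.
pose w := 3 * q - 2 * l.
have w0 : 0 < w by rewrite /w; lra.
have T1 : h ^+ 2 * ((l - 1) * (l - 2)) * w <= (h - 1) * (h - 2) * q ^+ 3.
  have l3 : 0 <= l ^+ 3 by rewrite exprn_ge0 // ltW.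
  have := ler_wpM2r l3 T.
  have -> : 6 * h ^+ 2 * M * (3 * a - 2) * l ^+ 3 = h ^+ 2 * (6 * l ^+ 2 * M) * w.
    by rewrite /w /q; ring.
  have -> : (h - 1) * (h - 2) * a ^+ 3 * l ^+ 3 = (h - 1) * (h - 2) * q ^+ 3.
    by rewrite /q; ring.
  by apply: le_trans; rewrite ler_pM2r // ler_pM2l // exprn_gt0.
have T2 : (h - 1) * (h - 2) * (l - 4) ^+ 2 <= h ^+ 2 * ((l - 5) * (l - 6)).
  rewrite -subr_ge0.
  have -> : h ^+ 2 * ((l - 5) * (l - 6)) - (h - 1) * (h - 2) * (l - 4) ^+ 2 =
    (l - 4 - h) * (h * (l - 6) + 2 * (l - 4) * (h - 1)) by ring.
  apply: mulr_ge0; first by lra.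
  by apply: addr_ge0; rewrite ?mulr_ge0 //; lra.
(* This compares q^3 / w with its value at q = l - 2, where w = l - 6; denominators are cleared
   because l = 6 is possible. *)
have T3 : (l - 6) * q ^+ 3 <= w * (l - 2) ^+ 3.
  rewrite -subr_ge0 /w.
  have -> : (3 * q - 2 * l) * (l - 2) ^+ 3 - (l - 6) * q ^+ 3 =
    (q - (l - 2)) * (2 * l * (q - (l - 2)) ^+ 2 +
       3 * q * (l - 2) * (2 * l - q - (l - 2))) by ring.
  apply: mulr_ge0; first by lra.
  apply: addr_ge0; first by rewrite mulr_ge0 ?sqr_ge0 // mulr_ge0 // ltW.
  by rewrite mulr_ge0 ?mulr_ge0 //; lra.
have q3 : 0 <= q ^+ 3 by rewrite exprn_ge0.
have h02 : 0 < h ^+ 2 by rewrite exprn_gt0.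
have T4 : (l - 1) * (l - 2) * w * (l - 4) ^+ 2 <= (l - 5) * ((l - 6) * q ^+ 3).
  rewrite -(ler_pM2l h02).
  have -> : h ^+ 2 * ((l - 1) * (l - 2) * w * (l - 4) ^+ 2) =
    (h ^+ 2 * ((l - 1) * (l - 2)) * w) * (l - 4) ^+ 2 by ring.
  apply: (@le_trans _ _ ((h - 1) * (h - 2) * q ^+ 3 * (l - 4) ^+ 2)).
    by apply: ler_wpM2r; [exact: sqr_ge0|exact: T1].
  have -> : (h - 1) * (h - 2) * q ^+ 3 * (l - 4) ^+ 2 =
    (h - 1) * (h - 2) * (l - 4) ^+ 2 * q ^+ 3 by ring.
  have -> : h ^+ 2 * ((l - 5) * ((l - 6) * q ^+ 3)) =
    h ^+ 2 * ((l - 5) * (l - 6)) * q ^+ 3 by ring.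
  by rewrite ler_wpM2r.
have : (l - 1) * (l - 2) * w * (l - 4) ^+ 2 <= (l - 5) * (w * (l - 2) ^+ 3).
  by apply: (le_trans T4); rewrite ler_wpM2l //; lra.
have wl : 0 < w * (l - 2) by rewrite mulr_gt0.
have -> : (l - 1) * (l - 2) * w * (l - 4) ^+ 2 = w * (l - 2) * ((l - 1) * (l - 4) ^+ 2) by ring.
have -> : (l - 5) * (w * (l - 2) ^+ 3) = w * (l - 2) * ((l - 5) * (l - 2) ^+ 2) by ring.
rewrite ler_pM2l // -subr_ge0.
have -> : (l - 5) * (l - 2) ^+ 2 - (l - 1) * (l - 4) ^+ 2 = - 4 by ring.
lra.
Qed.

(** * Consequences of the first-order conditions for 3-graphs *)

Section Critical.
Variables (E : {set {set V}}) (S : {set V}) (x : V -> R) (M : R) (L : nat).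
Hypotheses (ES : E \subset ksubs S 3) (x0 : forall i, 0 <= x i)
  (xS : forall i, i \in S -> 0 < x i) (x1 : \sum_(i in S) x i = 1)
  (wM : wt E x = M) (linkM : forall i, i \in S -> wt (link E i) x = 3 * M)
  (L4 : (4 <= L)%N) (KM : complete3 L <= M).

Let M0 : 0 < M. Proof. by apply: lt_le_trans KM; apply: complete3_gt0; lia. Qed.
Let LR : 4 <= L%:R :> R. Proof. by rewrite (ler_nat R 4). Qed.
Let LM : (L%:R - 1) * (L%:R - 2) <= 6 * L%:R ^+ 2 * M.
Proof.
rewrite -complete3M; last by lia.
by apply: ler_wpM2l => //; apply: mulr_ge0 => //; exact: sqr_ge0.
Qed.

Lemma sum_setD1 i : i \in S -> \sum_(j in S :\ i) x j = 1 - x i.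
Proof. by move=> iS; rewrite -x1 (big_setD1 i iS) /= addrC addrK. Qed.

Lemma link_sub2 i : i \in S -> link E i \subset ksubs (S :\ i) 2.
Proof. by move=> iS; rewrite -(link_ksubs _ iS) sub_link. Qed.

Lemma weight_le1 i : i \in S -> x i <= 1.
Proof. by move=> /sum_setD1 H; rewrite -subr_ge0 -H sumr_ge0. Qed.

Lemma degree_bound i : i \in S ->
  6 * M * #|S :\ i|%:R <= (#|S :\ i|%:R - 1) * (1 - x i) ^+ 2.
Proof.
move=> iS; have := maclaurin2 (S :\ i) x0; rewrite sum_setD1 //; apply: le_trans.
have -> : 6 * M * #|S :\ i|%:R = 2 * #|S :\ i|%:R * (3 * M) by ring.
apply: ler_wpM2l; first by rewrite mulr_ge0.
by rewrite -(linkM iS); apply: wt_le => //; exact: link_sub2.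
Qed.

(** By [degree_bound], 6 M <= (1 - x_i)^2. As M is at least [complete3 L], this gives (L - 1)(L - 2)
    <= (L (1 - x_i))^2, impossible when L x_i > 2. *)
Lemma weight_bound i : i \in S -> x i <= 2 / L%:R.
Proof.
move=> iS; have := degree_bound iS; have := weight_le1 iS.
case: (posnP #|S :\ i|) => [/eqP|].
  rewrite cards_eq0 => /eqP Si0; have := wt_le x0 (link_sub2 iS).
  by rewrite Si0 ksubs_set0 wt0 linkM //; move: M0; lra.
rewrite -(ltr0n R); move: #|S :\ i|%:R LR LM M0 => s HL HM HM0 s0 xi1 H.
have {}H : 6 * M <= (1 - x i) ^+ 2.
  by rewrite -(ler_pM2r s0); have := sqr_ge0 (1 - x i); nra.
rewrite ler_pdivlMr; last by lra.
move: (x i) (L%:R : R) HL HM xi1 H => a l HL HM xi1 H.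
have {}HM : (l - 1) * (l - 2) <= (l * (1 - a)) ^+ 2.
  apply: (le_trans HM); rewrite exprMn.
  have -> : 6 * l ^+ 2 * M = l ^+ 2 * (6 * M) by ring.
  by apply: ler_wpM2l => //; exact: sqr_ge0.
rewrite leNgt; apply/negP => al.
have : l * (1 - a) < l - 2 by lra.
have : 0 <= l * (1 - a) by apply: mulr_ge0; lra.
nra.
Qed.

Variable v : V.
Hypotheses (vS : v \in S) (vmin : forall i, i \in S -> x v <= x i).
Let t := x v.
Let t0 : 0 < t. Proof. exact: xS. Qed.

Definition missing : {set {set V}} := ksubs (S :\ v) 3 :\: del E v.

Lemma del_sub3 : del E v \subset ksubs (S :\ v) 3.
Proof. by rewrite -del_ksubs sub_del. Qed.

Lemma wt_del_min : wt (del E v) x = M * (1 - 3 * t).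
Proof. by have := wt_del_link E v x; rewrite wM linkM // -/t => H; lra. Qed.

Lemma missingP f : f \in missing -> [/\ f \subset S, v \notin f & #|f| = 3%N].
Proof.
rewrite !inE => /andP[_ /andP[]]; rewrite finset.subsetD1.
by move=> /andP[fS vf] /eqP cf.
Qed.

Lemma missing_prod f i : f \in missing -> i \in f -> t ^+ 2 * x i <= \prod_(j in f) x j.
Proof.
move=> /missingP[/fintype.subsetP fS vf cf]; apply: prod3_lb => //; first exact: ltW.
by move=> j /fS /vmin.
Qed.

Lemma min_weight : t * #|S|%:R <= 1.
Proof. by rewrite mulr_natr -x1 -sumr_const; apply: ler_sum => i /vmin. Qed.

Lemma card_missing_lt : #|S| = L.+1 -> (#|missing| < L)%N.
Proof.
move=> cS; have cv : #|S :\ v| = L by move: cS; rewrite (cardsD1_in vS) => -[].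
(* With L + 1 supporting vertices no weight exceeds 1 / (L - 1): otherwise [degree_bound] would
   yield (L - 1)^2 < L (L - 2). *)
set a : R := (L%:R - 1)^-1.
have L1 : 0 < L%:R - 1 :> R by move: LR; lra.
have a0 : 0 < a by rewrite invr_gt0.
have aL : a * (L%:R - 1) = 1 by rewrite mulVf // gt_eqF.
have xa i : i \in S -> x i <= a.
  move=> iS; have := degree_bound iS; have := weight_le1 iS.
  have -> : #|S :\ i| = L by move: cS; rewrite (cardsD1_in iS) => -[].
  rewrite -[x i <= a](ler_pM2r L1) aL; move: (x i) (L%:R : R) LR LM L1 => b l HL HM l1 b1 H.
  have {}HM : (l - 2) * l <= (l * (1 - b)) ^+ 2.
    rewrite -(ler_pM2l l1); apply: (@le_trans _ _ (l * ((l - 1) * (l - 2)))).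
      by rewrite le_eqVlt; apply/orP; left; apply/eqP; ring.
    apply: (@le_trans _ _ (l * (6 * l ^+ 2 * M))); first by apply: ler_wpM2l => //; lra.
    have -> : l * (6 * l ^+ 2 * M) = l ^+ 2 * (6 * M * l) by ring.
    rewrite exprMn [leRHS]mulrCA; apply: ler_wpM2l => //; exact: sqr_ge0.
  have {}HM : l - 2 <= l * (1 - b) ^+ 2.
    have l0 : 0 < l by lra.
    by rewrite -(ler_pM2r l0); move: HM; nra.
  rewrite leNgt; apply/negP => bl.
  have H1 : (1 - b) * (l - 1) < l - 2 by lra.
  have H2 : 0 <= (1 - b) * (l - 1) by apply: mulr_ge0; lra.
  have H3 : ((1 - b) * (l - 1)) ^+ 2 < (l - 2) ^+ 2 by nra.
  have H4 : (l - 2) * (l - 1) ^+ 2 <= l * ((1 - b) * (l - 1)) ^+ 2.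
    rewrite exprMn [leRHS]mulrA; apply: ler_wpM2r => //; exact: sqr_ge0.
  have l0 : 0 < l by lra.
  have l2 : 0 < l - 2 by lra.
  have : (l - 2) * (l - 1) ^+ 2 < (l - 2) * (l * (l - 2)).
    apply: (le_lt_trans H4).
    have -> : (l - 2) * (l * (l - 2)) = l * (l - 2) ^+ 2 by ring.
    by rewrite ltr_pM2l.
  by rewrite ltr_pM2l //; lra.
(* Otherwise the four vertices of v |: f weigh at most a / 2 and the others at most a,
   for a total below 1. *)
have xf f : f \in missing -> exists2 i, i \in f & a / 2 <= x i.
  move=> fm; have [fS vf cf] := missingP fm.
  case: (boolP [exists i in f, a / 2 <= x i]) => [/exists_inP[i]|]; first by exists i.
  rewrite negb_exists_in => /forall_inP lt.
  exfalso; have : \sum_(i in S) x i < 1; last by rewrite x1 ltxx.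
  have vfS : v |: f \subset S by rewrite finset.subUset finset.sub1set vS fS.
  have c4 : #|v |: f| = 4%N by rewrite cardsU1 vf cf.
  rewrite (big_setID (v |: f)) /= (finset.setIidPr vfS).
  have s1 : \sum_(i in v |: f) x i < 2 * a.
    have /card_gt0P[k kf] : (0 < #|f|)%N by rewrite cf.
    have tk : t < a / 2.
      apply: le_lt_trans (vmin (fintype.subsetP fS _ kf)) _.
      by rewrite ltNge; exact: lt.
    rewrite big_setU1 //= -/t.
    have : \sum_(i in f) x i <= \sum_(i in f) (a / 2).
      by apply: ler_sum => i fi; apply: ltW; rewrite ltNge; exact: lt.
    rewrite sumr_const cf; lra.
  have s2 : \sum_(i in S :\: (v |: f)) x i <= (L%:R - 3) * a.
    have -> : (L%:R - 3) * a = \sum_(i in S :\: (v |: f)) a.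
      rewrite sumr_const cardsDS // cS c4 -(mulr_natl a); congr (_ * _).
      by rewrite subSS natrB // ltnW.
    by apply: ler_sum => i; rewrite finset.in_setD => /andP[_ /xa].
  move: s1 s2 aL; move: (\sum_(i in v |: f) x i) (\sum_(i in S :\: (v |: f)) x i) => p q.
  by move: (L%:R : R) => l; lra.
have e3 : 6 * L%:R ^+ 2 * wt (ksubs (S :\ v) 3) x
    <= (L%:R - 1) * (L%:R - 2) * (1 - t) ^+ 3.
  by have := maclaurin3 (S :\ v) x0; rewrite sum_setD1 // cv.
have wF : wt missing x = wt (ksubs (S :\ v) 3) x - M * (1 - 3 * t).
  by rewrite (wtD x del_sub3) -/missing wt_del_min; ring.
have lF : #|missing|%:R * (t ^+ 2 * (a / 2)) <= wt missing x.
  rewrite mulr_natl -sumr_const; apply: ler_sum => f fm.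
  have [i fi ai] := xf _ fm; apply: (le_trans _ (missing_prod fm fi)).
  by apply: ler_wpM2l => //; exact: sqr_ge0.
have t3 : 0 <= 1 - 3 * t.
  by have := min_weight; rewrite cS -[L.+1%:R]natr1; move: LR t0; nra.
rewrite ltnNge; apply/negP; rewrite -(ler_nat R) => Lm.
have : L%:R * (t ^+ 2 * (a / 2)) <= wt missing x.
  apply: le_trans lF; apply: ler_wpM2r => //.
  by apply: mulr_ge0; [exact: sqr_ge0|lra].
have L2 : 0 < 6 * L%:R ^+ 2 :> R by apply: mulr_gt0 => //; apply: exprn_gt0; move: LR; lra.
rewrite -(ler_pM2l L2) wF mulrBr => H.
(* Since (1 - t)^3 - (1 - 3 t) = 3 t^2 - t^3, cancelling 3 t^2 will leave L^3 <= (L - 1)^2 (L - 2),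
   which is false. *)
have {H} : 6 * L%:R ^+ 2 * (L%:R * (t ^+ 2 * (a / 2)))
   <= (L%:R - 1) * (L%:R - 2) * (3 * t ^+ 2).
  apply: (le_trans H); apply: (@le_trans _ _ ((L%:R - 1) * (L%:R - 2) * ((1 - t) ^+ 3 - (1 - 3 * t)))).
    rewrite [leRHS]mulrBr; apply: lerB => //; rewrite mulrA.
    exact: ler_wpM2r.
  apply: ler_wpM2l; first by apply: mulr_ge0; move: LR; lra.
  have := exprn_gt0 3 t0; lra.
have -> : 6 * L%:R ^+ 2 * (L%:R * (t ^+ 2 * (a / 2))) = 3 * t ^+ 2 * (L%:R ^+ 3 * a).
  by field.
have t2 : 0 < 3 * t ^+ 2 by apply: mulr_gt0 => //; apply: exprn_gt0.
rewrite [leRHS]mulrC ler_pM2l // -(ler_pM2r L1) -mulrA aL.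
by move: LR; move: (L%:R : R) => l HL; nra.
Qed.

(** [del E v :|: A] has at most as many edges as [E]. The bound M (1 - t)^3 is extremality rescaled
    to the total weight 1 - t left after deleting [v]; subtracting M (1 - 3 t) leaves M (3 t^2 -
    t^3). *)
Lemma wt_missing_lt A :
  (forall E', E' \subset ksubs (S :\ v) 3 -> (#|E'| <= #|E|)%N ->
     wt E' x <= M * (1 - t) ^+ 3) ->
  A \subset missing -> (#|A| <= #|link E v|)%N -> wt A x < 3 * M * t ^+ 2.
Proof.
move=> hH Am cA.
have dA : [disjoint del E v & A].
  rewrite -finset.setI_eq0; apply/eqP/finset.setP => e; rewrite finset.in_setI finset.in_set0.
  by apply/negP => /andP[ed /(fintype.subsetP Am)]; rewrite finset.in_setD ed.
have sub : del E v :|: A \subset ksubs (S :\ v) 3.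
  rewrite finset.subUset del_sub3 /=.
  exact: fintype.subset_trans Am (finset.subsetDl _ _).
have card : (#|del E v :|: A| <= #|E|)%N.
  by rewrite (card_del_linkE E v); apply: (leq_trans (leq_card_setU _ _)); rewrite leq_add2l.
have := hH _ sub card; rewrite wtU // wt_del_min.
have : 0 < M * t ^+ 3 by apply: mulr_gt0 => //; exact: exprn_gt0.
lra.
Qed.

(** * Supports with at least L + 2 vertices *)

Section LargeSupport.
Hypotheses (leS : (L.+2 <= #|S|)%N)
  (leE : (#|E| + 2 * (L - 1) <= 'C(L.+1, 3))%N)
  (hH : forall E', E' \subset ksubs (S :\ v) 3 -> (#|E'| <= #|E|)%N ->
     wt E' x <= M * (1 - t) ^+ 3).

Let D : R := #|link E v|%:R.
Let D0 : 0 < D.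
Proof.
rewrite ltr0n card_gt0; apply/eqP => l0.
by move: (linkM vS) M0; rewrite l0 wt0; lra.
Qed.

Let mu := 3 * M / D.
Let mu0 : 0 < mu. Proof. by rewrite divr_gt0 // mulr_gt0. Qed.
Let muD : D * mu = 3 * M. Proof. by rewrite /mu mulrC divfK // gt_eqF. Qed.

(** The threshold [mu] is chosen so that [D] triples of weight at least t^2 mu together reach 3 M
    t^2, which [wt_missing_lt] forbids. *)
Definition heavy : {set V} := [set i in S :\ v | mu <= x i].

Let Hsub : heavy \subset S :\ v.
Proof. by apply/fintype.subsetP => i; rewrite inE => /andP[]. Qed.

Let HS : heavy \subset S.
Proof. exact: fintype.subset_trans Hsub (finset.subD1set _ _). Qed.

Let light i : i \in (S :\ v) :\: heavy -> x i < mu.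
Proof. by rewrite finset.in_setD inE negb_and ltNge => /andP[/orP[/negbTE ->|//]]. Qed.

Lemma card_missing_heavy :
  (#|[set f in missing | ~~ (f \subset (S :\ v) :\: heavy)]| < #|link E v|)%N.
Proof.
rewrite ltnNge; apply/negP => le.
have /card_gt0P[A] : (0 < #|ksubs [set f in missing | ~~ (f \subset (S :\ v) :\: heavy)]%SET
  #|link E v| |)%N by rewrite card_ksubs bin_gt0.
rewrite inE => /andP[As /eqP cA].
have Am : A \subset missing.
  by apply: (fintype.subset_trans As); apply/fintype.subsetP => f; rewrite inE => /andP[].
have := wt_missing_lt hH Am; rewrite cA leqnn => /(_ isT); apply/negP; rewrite -leNgt.
rewrite -muD /D -cA -mulrA mulr_natl -sumr_const; apply: ler_sum => f fA.
move/fintype.subsetP: As => /(_ _ fA); rewrite inE => /andP[fm /subsetPn[i fi]].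
have [fS vf _] := missingP fm.
have iv : i \in S :\ v.
  rewrite in_setD1 (fintype.subsetP fS _ fi) andbT.
  by apply: contraNneq vf => <-.
rewrite finset.in_setD iv andbT negbK inE iv /= => mui.
apply: (le_trans _ (missing_prod fm fi)); rewrite mulrC.
by apply: ler_wpM2l => //; exact: sqr_ge0.
Qed.

(** Each triple of [S :\ v] is an edge, a missing triple with a heavy vertex, or a triple of light
    vertices; [heavy_count] exploits this cover. *)
Lemma card_heavy : (#|heavy| + 4 <= L)%N.
Proof.
set h := #|heavy|; set k := #|S :\ v|.
have kL : (L.+1 <= k)%N by move: leS; rewrite (cardsD1_in vS).
have cover : (#|ksubs (S :\ v) 3| <= #|del E v| +
    #|[set f in missing | ~~ (f \subset (S :\ v) :\: heavy)]|
    + #|ksubs ((S :\ v) :\: heavy) 3|)%N.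
  apply: (@leq_trans #|del E v :|: [set f in missing | ~~ (f \subset (S :\ v) :\: heavy)]%SET
     :|: ksubs ((S :\ v) :\: heavy) 3|).
    apply: subset_leq_card; apply/fintype.subsetP => f fS.
    rewrite !finset.in_setU; case: (boolP (f \in del E v)) => //= fE.
    rewrite inE finset.in_setD fE fS /=; case: (boolP (f \subset _)) => //= fl.
    by move: fS; rewrite inE => /andP[_ cf]; rewrite inE fl.
  apply: (leq_trans (leq_card_setU _ _)); rewrite leq_add2r.
  exact: leq_card_setU.
have ch : #|(S :\ v) :\: heavy| = (k - h)%N by rewrite cardsDS.
move: cover; rewrite !card_ksubs ch -/k => cover.
exact: (heavy_count L4 kL (card_del_linkE E v) cover card_missing_heavy leE).
Qed.

Let rho := 1 - \sum_(i in heavy) x i.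

Let sum_light : \sum_(i in S :\: heavy) x i = rho.
Proof. by rewrite /rho -x1 [X in _ = X - _](big_setID heavy) /= (finset.setIidPr HS) addrAC subrr add0r. Qed.

Let rho0 : 0 <= rho. Proof. by rewrite -sum_light sumr_ge0. Qed.
Let rho1 : rho <= 1.
Proof. by rewrite /rho gerBl sumr_ge0. Qed.

(** A pair of the link of [v] not inside [heavy] has one vertex lighter than [mu] and another of
    weight at most 2 / L. There are at most [D] such pairs, and D mu = 3 M. *)
Lemma heavy_pairs : 3 * M * (1 - 2 / L%:R) <= wt (ksubs heavy 2) x.
Proof.
have lowprod e : e \in link E v :\: ksubs heavy 2 ->
    \prod_(i in e) x i <= mu * (2 / L%:R).
  rewrite finset.in_setD => /andP[eh el].
  have := fintype.subsetP (link_sub2 vS) _ el; rewrite inE => /andP[eS /eqP ce].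
  have : ~~ (e \subset heavy) by move: eh; rewrite inE ce eqxx andbT.
  move=> /subsetPn[i ie ih].
  have iS : i \in S :\ v := fintype.subsetP eS _ ie.
  rewrite (big_setD1 i ie) /=; apply: ler_pM => //.
  - exact: prodr_ge0.
  - by apply: ltW; apply: light; rewrite finset.in_setD ih.
  have /cards1P[j ej] : #|e :\ i| == 1%N by move: ce; rewrite (cardsD1_in ie) => -[->].
  rewrite ej big_set1; apply: weight_bound.
  have : j \in e :\ i by rewrite ej inE.
  by rewrite in_setD1 => /andP[_ /(fintype.subsetP eS)]; rewrite in_setD1 => /andP[].
have split : wt (link E v) x = wt (link E v :&: ksubs heavy 2) x
    + wt (link E v :\: ksubs heavy 2) x by rewrite /wt (big_setID (ksubs heavy 2)).
have l1 : wt (link E v :&: ksubs heavy 2) x <= wt (ksubs heavy 2) x.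
  by apply: wt_le => //; exact: finset.subsetIr.
have l2 : wt (link E v :\: ksubs heavy 2) x <= 3 * M * (2 / L%:R).
  apply: (@le_trans _ _ (\sum_(e in link E v :\: ksubs heavy 2) mu * (2 / L%:R))).
    exact: ler_sum.
  rewrite sumr_const -(mulr_natl (mu * _)) -muD -(mulrA D); apply: ler_wpM2r.
    by apply: mulr_ge0; [exact: ltW|apply: divr_ge0].
  by rewrite ler_nat subset_leq_card // finset.subsetDl.
by move: split (linkM vS); lra.
Qed.

(** Summing x_i times the derivative at i over the vertices outside [heavy] gives 3 M rho and counts
    every edge not inside [heavy] at least once. *)
Lemma heavy_triples : M * (1 - 3 * rho) <= wt (ksubs heavy 3) x.
Proof.
have split : M = wt (E :&: ksubs heavy 3) x + wt (E :\: ksubs heavy 3) x.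
  by rewrite -wM /wt (big_setID (ksubs heavy 3)).
have l1 : wt (E :&: ksubs heavy 3) x <= wt (ksubs heavy 3) x.
  by apply: wt_le => //; exact: finset.subsetIr.
have l2 : wt (E :\: ksubs heavy 3) x <= 3 * M * rho.
  have -> : 3 * M * rho = \sum_(i in S :\: heavy) \sum_(e in E | i \in e) \prod_(j in e) x j.
    rewrite -sum_light mulr_sumr; apply: eq_bigr => i; rewrite finset.in_setD => /andP[_ iS].
    by rewrite -(linkM iS) mulrC wt_mem.
  rewrite (exchange_big_dep (mem E)) /=; last by move=> ? ? _ /andP[].
  apply: (@le_trans _ _ (\sum_(e in E :\: ksubs heavy 3) \sum_(i in S :\: heavy | (e \in E) && (i \in e))
     \prod_(j in e) x j)).
    apply: ler_sum => e; rewrite finset.in_setD => /andP[eh eE].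
    have := fintype.subsetP ES _ eE; rewrite inE => /andP[eS ce].
    have /subsetPn[i ie ih] : ~~ (e \subset heavy) by move: eh; rewrite inE ce andbT.
    rewrite [leRHS](bigD1 i) /=; last by rewrite finset.in_setD ih (fintype.subsetP eS) //= eE.
    by rewrite lerDl; apply: sumr_ge0 => *; exact: prodr_ge0.
  rewrite [leRHS](big_setID (E :\: ksubs heavy 3)) /= (finset.setIidPr (finset.subsetDl _ _)).
  by rewrite lerDl; apply: sumr_ge0 => e _; apply: sumr_ge0 => i _; exact: prodr_ge0.
by lra.
Qed.

Lemma large_support_absurd : False.
Proof.
have L0 : 0 < L%:R :> R by move: LR; lra.
have P := heavy_pairs; have T := heavy_triples.
have s1 : \sum_(i in heavy) x i = 1 - rho by rewrite /rho; ring.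
have P2 := maclaurin2 heavy x0; have T3 := maclaurin3 heavy x0.
rewrite s1 in P2 T3; have hL := card_heavy.
set h := #|heavy| in P2 T3 hL.
have M3 : 0 < 3 * M * (1 - 2 / L%:R).
  by rewrite mulr_gt0 ?mulr_gt0 // subr_gt0 ltr_pdivrMr // mul1r; move: LR; lra.
have h2 : (2 <= h)%N.
  rewrite ltnNge; apply/negP; rewrite leq_eqVlt ltnS leqn0 => /orP[/eqP h1|/eqP h0].
    by move: P2; rewrite h1; lra.
  move/eqP: h0; rewrite cards_eq0 => /eqP h0.
  by move: P; rewrite h0 ksubs_set0 wt0; lra.
apply: (@large_support_numeric h%:R L%:R M (1 - rho)) => //.
- by rewrite (ler_nat R 2).
- by rewrite -(natrD R h 4) ler_nat.
- by rewrite subr_ge0 rho1.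
- by rewrite gerBl rho0.
- apply: le_trans P2; rewrite -[6%:R * _ * _ * _]mulrA.
  have h0 : 0 <= 2 * h%:R :> R by rewrite mulr_ge0.
  have := ler_wpM2l h0 P; apply: le_trans; rewrite le_eqVlt; apply/orP; left; apply/eqP; ring.
- apply: le_trans T3; have h0 : 0 <= 6 * h%:R ^+ 2 :> R by rewrite mulr_ge0 ?sqr_ge0.
  have := ler_wpM2l h0 T; apply: le_trans; rewrite le_eqVlt; apply/orP; left; apply/eqP; ring.
Qed.

End LargeSupport.

End Critical.
End TripleBounds.

(** * The support of an extremal weighted 3-graph *)

Section NoClique.
Variables (R : realType) (n : nat).
Implicit Types (E A : {set {set 'I_n}}) (x y : 'I_n -> R).

Definition supp x : {set 'I_n} := [set i | 0 < x i].

Lemma wt_supp E x : (forall i, 0 <= x i) ->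
  wt E x = wt [set e in E | e \subset supp x] x.
Proof.
move=> x0; set E1 := (X in _ = wt X x).
have sub : E1 \subset E by apply/fintype.subsetP => e; rewrite inE => /andP[].
rewrite (wtD x sub) [X in _ + X]big1 ?addr0 // => e.
rewrite finset.in_setD inE => /andP[+ eE]; rewrite eE /= => /subsetPn[i ie].
rewrite inE -leNgt => xi; rewrite (bigD1 i ie) /=.
by have -> : x i = 0; [apply/eqP; rewrite eq_le xi x0|rewrite mul0r].
Qed.

Lemma sum_supp x : splx x -> \sum_(i in supp x) x i = 1.
Proof.
move=> [x0 <-]; rewrite [RHS](bigID (mem (supp x))) /= [X in _ + X]big1 ?addr0 // => i.
by rewrite inE -leNgt => xi; apply/eqP; rewrite eq_le xi x0.
Qed.

Lemma restrict_supp r E x : {in E, forall e : {set 'I_n}, #|e| = r} ->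
  [set e in E | e \subset supp x] \subset ksubs (supp x) r.
Proof.
move=> u; apply/fintype.subsetP => e; rewrite !inE => /andP[/u -> ->].
by rewrite eqxx.
Qed.

Lemma wt_le_complete3 L E x : (3 <= L)%N -> {in E, forall e : {set 'I_n}, #|e| = 3%N} ->
  splx x -> (#|supp x| <= L)%N -> wt E x <= complete3 R L.
Proof.
move=> L3 u sx cs; rewrite wt_supp; last by case: sx.
apply: le_trans (wt_le (sx.1) (restrict_supp x u)) _.
by apply: ksubs3_le_complete3 => //; [case: sx|rewrite sum_supp].
Qed.

Lemma bin3_succ L : (4 <= L)%N -> 'C(L.+1, 3) = ('C(L, 3) + 'C(L.-1, 2) + (L - 1))%N.
Proof. by case: L => // L _; rewrite (binS L.+1 2) (binS L 1) bin1 subn1 /=; lia. Qed.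

(** With L + 1 supporting vertices, a nonempty set of at most L - 1 new triples makes [S :\ v] a
    clique. The enlarged graph then weighs at most [complete3 L], yet strictly more than [E]. *)
Lemma extremal_support L m E x : (4 <= L)%N ->
  (m + (L - 1) <= 'C(L, 3) + 'C(L.-1, 2))%N ->
  {in E, forall e : {set 'I_n}, #|e| = 3%N} -> (#|E| <= m)%N ->
  splx x -> complete3 R L <= wt E x ->
  (forall E' y, {in E', forall e : {set 'I_n}, #|e| = 3%N} -> (#|E'| <= m)%N ->
     splx y -> wt E' y <= wt E x) ->
  (#|supp x| <= L)%N.
Proof.
move=> L4 hm u cE sx KM ext; rewrite leqNgt; apply/negP => leS.
have L3 : (3 <= L)%N := ltnW L4.
have L2 : (0 < L - 1)%N by rewrite subn_gt0 (leq_trans _ L4).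
have [x0 x1] := sx; set S := supp x in leS *.
set E1 := [set e in E | e \subset S]%SET.
have ES : E1 \subset ksubs S 3 := restrict_supp x u.
have u1 := ksubs_card_eq ES.
have c1 : (#|E1| <= m)%N.
  apply: leq_trans cE; apply: subset_leq_card.
  by apply/fintype.subsetP => e; rewrite inE => /andP[].
have w1 : wt E1 x = wt E x by rewrite [RHS]wt_supp.
have mx : maximizer E1 x by split=> // y sy; rewrite w1; apply: ext.
have xS i : i \in S -> 0 < x i by rewrite inE.
have linkM i : i \in S -> wt (link E1 i) x = 3 * wt E x.
  by move=> iS; rewrite (link_maximizer u1 mx (xS _ iS)) w1.
have [|v vS vmin] := @exists_argmin _ _ S x.
  by rewrite -card_gt0; apply: leq_trans leS.
have binL := bin3_succ L4.
have leE : (#|E1| + 2 * (L - 1) <= 'C(L.+1, 3))%N.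
  rewrite binL mul2n -addnn addnA leq_add2r; apply: leq_trans hm.
  by rewrite leq_add2r.
have sS : \sum_(i in S) x i = 1 by apply: sum_supp.
move: leS; rewrite leq_eqVlt => /orP[/eqP/esym cS|leS]; last first.
  apply: (large_support_absurd ES x0 xS sS w1 linkM L4 KM vS vmin leS leE).
  move=> E' E'S cE'.
  have t1 : x v < 1.
    have := min_weight sS vmin; have : (2%:R <= #|S|%:R :> R).
      by rewrite ler_nat; apply: leq_trans leS; rewrite !ltnS (leq_trans _ L4).
    have := xS _ vS; move: (x v) (#|S|%:R : R) => a b; nra.
  have t0 : 0 < 1 - x v by rewrite subr_gt0.
  (* Deleting [v] and dividing by [1 - x v] gives a point of the simplex, which turns [ext] into the
     rescaled bound required. *)
  pose z i := if i == v then 0 else x i.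
  have z0 i : 0 <= z i by rewrite /z; case: eqP.
  have zs : \sum_i z i = 1 - x v.
    rewrite -x1 (bigD1 v) //= [in RHS](bigD1 v) //= addrAC subrr add0r {1}/z eqxx add0r.
    by apply: eq_bigr => i /negbTE iv; rewrite /z iv.
  have sz : splx (fun i => (1 - x v)^-1 * z i).
    split=> [i|]; first by rewrite mulr_ge0 // invr_ge0 ltW.
    by rewrite -mulr_sumr zs mulVf // gt_eqF.
  have u' := ksubs_card_eq E'S.
  have := ext _ _ u' (leq_trans cE' c1) sz.
  rewrite (wt_scale _ _ u') exprVn mulrC ler_pdivrMr ?exprn_gt0 //.
  rewrite (@eq_wt _ _ _ z x) // => e i /(fintype.subsetP E'S); rewrite inE.
  rewrite finset.subsetD1 => /andP[/andP[_ ve] _] ie; rewrite /z.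
  by case: eqP => // iv; rewrite -iv ie in ve.
have qL := card_missing_lt ES x0 xS sS w1 linkM L4 KM vS vmin cS.
have cT : #|S :\ v| = L by move: cS; rewrite (cardsD1_in vS) => -[].
(* Strictness needs [A] nonempty: if [S :\ v] is already a clique, any single non-edge inside [S]
   serves. *)
have [A [AS A0 cA clA]] : exists A, [/\ A \subset ksubs S 3 :\: E1, A != finset.set0,
    (#|A| <= L - 1)%N & ksubs (S :\ v) 3 \subset E1 :|: A].
  have cl : ksubs (S :\ v) 3 \subset E1 :|: missing E1 S v.
    apply/fintype.subsetP => f fT; rewrite finset.in_setU /missing finset.in_setD fT andbT.
    by case: (boolP (f \in del E1 v)) => [/(fintype.subsetP (del_sub _ _)) ->|]; rewrite ?orbT.
  case: (eqVneq (missing E1 S v) finset.set0) => [m0|m0]; last first.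
    exists (missing E1 S v); split=> //; last by rewrite subn1 -ltnS (ltn_predK L4).
    apply/fintype.subsetP => f; rewrite /missing !finset.in_setD => /andP[fE fT].
    rewrite (fintype.subsetP (subset_ksubs 3 (finset.subD1set S v)) _ fT) andbT.
    apply: contra fE => fE; rewrite inE fE /=.
    by move: fT; rewrite inE finset.subsetD1 => /andP[/andP[]].
  have /subsetPn[f fS fE] : ~~ (ksubs S 3 \subset E1).
    apply/negP => /subset_leq_card; rewrite card_ksubs cS; apply/negP; rewrite -ltnNge.
    by apply: leq_trans leE; rewrite -[X in (X < _)%N]addn0 ltn_add2l muln_gt0.
  exists [set f]%SET; split.
  - by rewrite finset.sub1set finset.in_setD fE.
  - by apply/finset.set0Pn; exists f; rewrite inE.
  - by rewrite cards1.
  - apply: (fintype.subset_trans cl); rewrite m0 finset.setU0.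
    exact: finset.subsetUl.
have AS3 : A \subset ksubs S 3 by apply: (fintype.subset_trans AS); exact: finset.subsetDl.
have dA : [disjoint E1 & A].
  rewrite -finset.setI_eq0; apply/eqP/finset.setP => e; rewrite finset.in_setI finset.in_set0.
  by apply/negP => /andP[ed /(fintype.subsetP AS)]; rewrite finset.in_setD ed.
have EAS : E1 :|: A \subset ksubs S 3 by rewrite finset.subUset ES AS3.
have : wt (E1 :|: A) x <= complete3 R L.
  apply: (near_clique_bound (p := 0) EAS vS clA _ _ _ sx); rewrite cT //.
  (* For [p = 0] the correction term vanishes, and the margin L - 1 in [hm] pays for the triples of
     [A]. *)
  - rewrite expn0 subnn mul0n addn0 -(leq_add2l 'C(L, 3)).
    have := card_del_linkE (E1 :|: A) v; rewrite (del_near_clique EAS clA) card_ksubs cT => <-.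
    by apply: leq_trans hm; apply: (leq_trans (leq_card_setU _ _)); apply: leq_add.
  - move=> T y cTL [y0 y1]; apply: ksubs3_le_complete3 => //.
    rewrite -y1 [leRHS](bigID (mem T)) /= lerDl; exact: sumr_ge0.
rewrite wtU // w1; move/finset.set0Pn: A0 => [f fA].
by have := wt_gt0 xS AS3 fA; move: KM; lra.
Qed.

End NoClique.

(** * Strict inequality for 3-graphs without a large clique *)

Section NoCliqueTheorem.
Variable R : realType.

Lemma complete3_le_lagrangian L : (3 <= L)%N ->
  complete3 R L <= lagrangian R (complete_graph 3 L).
Proof.
case: L => [|[|[|k]]] // _; set L := k.+3.
have L0 : 0 < L%:R :> R by rewrite ltr0n.
have := @wt_le_lagrangian R 3 L (complete_graph 3 L) (fun=> L%:R^-1 * 1) isT.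
rewrite (wt_scale (r := 3)) ?wt_card; last exact: edges_card.
rewrite edges_complete card_ksubs cardsT card_ord => H.
suff <- : L%:R^-1 ^+ 3 * 'C(L, 3)%:R = complete3 R L.
  apply: H => [i|]; first by rewrite mulr1 invr_ge0 ltW.
  by rewrite sumr_const card_ord mulr1 -(mulr_natl L%:R^-1) mulfV // gt_eqF.
have := bin_ffact L 3; rewrite !ffactnS ffactn0 muln1 /= => /(congr1 (fun m => m%:R : R)).
rewrite !natrM /complete3.
have -> : k.+2%:R = L%:R - 1 :> R by rewrite /L -[k.+3%:R]natr1 addrK.
have -> : k.+1%:R = L%:R - 2 :> R.
  by rewrite /L -[k.+3%:R]natr1 -[k.+2%:R]natr1; ring.
have -> : (3`!)%:R = 6 :> R by [].
move=> B; have -> : 'C(L, 3)%:R = L%:R * ((L%:R - 1) * (L%:R - 2)) / 6 :> R.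
  by rewrite -B; field.
by field; rewrite gt_eqF.
Qed.

(** If [G] reached [complete3 L], the support bound for an extremal graph would cap all values
    there, making [G] itself extremal. Its maximizer [z] then has at most L supporting vertices;
    fewer contradict [complete3_lt], and exactly L leave a non-edge whose weight is lost. *)
Lemma lagrangian_no_clique L n (G : uniform_graph 3 n) : (4 <= L)%N ->
  (0 < #|edges G|)%N -> (#|edges G| + (L - 1) <= 'C(L, 3) + 'C(L.-1, 2))%N ->
  ~ has_clique G L ->
  lagrangian R G < lagrangian R (complete_graph 3 L).
Proof.
move=> L4 cG0 hm ncl; have L3 : (3 <= L)%N := ltnW L4.
apply: lt_le_trans (complete3_le_lagrangian L3); rewrite ltNge; apply/negP => KG.
have n0 : (0 < n)%N.
  have /card_gt0P[e eG] := cG0.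
  by have := max_card (mem e); rewrite (edges_card eG) card_ord; apply: leq_trans.
set m := #|edges G| in hm.
(* The maximum is taken over the finite type of all set families; intersecting with the triples
   makes each family a 3-graph. *)
have ucard (E : {set {set 'I_n}}) (e : {set 'I_n}) :
    e \in (E :&: ksubs [set: 'I_n] 3)%SET -> #|e| = 3%N.
  by rewrite !inE => /andP[_ /andP[_ /eqP]].
pose mk E := UniformGraph (ucard E).
have mkE (E : {set {set 'I_n}}) : {in E, forall e : {set 'I_n}, #|e| = 3%N} -> edges (mk E) = E.
  move=> u; apply/finset.setIidPl/fintype.subsetP => e eE.
  by rewrite inE finset.subsetT u.
have uG : {in edges G, forall e : {set 'I_n}, #|e| = 3%N} by move=> e; exact: edges_card.
have [E cE Emax] := @arg_maxP _ R _ (edges G) (fun E => #|E| <= m)%N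
  (fun E => lagrangian R (mk E)) (leqnn _).
have [x [sx mx] wx] := @lagrangian_maximizer R 3 n (mk E) n0.
have ext (E' : {set {set 'I_n}}) (y : 'I_n -> R) :
    {in E', forall e : {set 'I_n}, #|e| = 3%N} -> (#|E'| <= m)%N ->
    splx y -> wt E' y <= lagrangian R (mk E).
  move=> u' c' [y0 y1]; apply: le_trans (Emax _ c').
  by rewrite -{1}(mkE _ u'); apply: wt_le_lagrangian => //; rewrite y1.
have [z [sz mz] wz] := lagrangian_maximizer R G n0.
have KE : complete3 R L <= lagrangian R (mk E).
  by apply: (le_trans KG); rewrite -wz; apply: ext.
have cE' : (#|edges (mk E)| <= m)%N.
  by apply: leq_trans cE; apply: subset_leq_card; exact: finset.subsetIl.
have sE : (#|supp x| <= L)%N.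
  apply: (extremal_support L4 hm _ cE' sx) => [e||E' y u' c' sy]; first exact: edges_card.
    by rewrite wx.
  by rewrite wx; apply: ext.
have EK : lagrangian R (mk E) <= complete3 R L.
  by rewrite -wx; apply: wt_le_complete3 => // e; exact: edges_card.
have sG : (#|supp z| <= L)%N.
  apply: (extremal_support L4 hm uG (leqnn _) sz) => [|E' y u' c' sy]; first by rewrite wz.
  by rewrite wz; apply: le_trans KG; apply: le_trans EK; apply: ext.
move: sG; rewrite leq_eqVlt => /orP[/eqP cz|cz]; last first.
  have LL : L.-1.+1 = L := ltn_predK L4.
  have L3' : (3 <= L.-1)%N by rewrite -ltnS LL.
  have : wt (edges G) z <= complete3 R L.-1 by apply: wt_le_complete3 => //; rewrite -ltnS LL.
  rewrite wz; apply/negP; rewrite -ltNge; apply: lt_le_trans KG.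
  by rewrite -[in ltRHS]LL; apply: complete3_lt.
have z0 := sz.1.
have [f [fz cf fG]] : exists f : {set 'I_n}, [/\ f \subset supp z, #|f| = 3%N & f \notin edges G].
  apply: contrapT => no; apply: ncl; exists (supp z) => // e es ce.
  by apply: contrapT => /negP eG; apply: no; exists e.
have : wt (edges G) z < complete3 R L; last by rewrite wz ltNge KG.
rewrite wt_supp //; set G1 := [set e in _ | _]%SET.
have fz3 : [set f]%SET \subset ksubs (supp z) 3 by rewrite finset.sub1set inE fz cf.
have dis : [disjoint G1 & [set f]%SET].
  by rewrite disjoint_sym disjoints1 inE negb_and fG.
apply: (@lt_le_trans _ _ (wt (G1 :|: [set f]%SET) z)).
  rewrite wtU // ltrDl; apply: (wt_gt0 (S := supp z) (r := 3) (e := f)) => //; last by rewrite inE.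
  by move=> i; rewrite inE.
apply: (@le_trans _ _ (wt (ksubs (supp z) 3) z)).
  by apply: wt_le => //; rewrite finset.subUset fz3 restrict_supp.
by apply: ksubs3_le_complete3; rewrite ?cz ?sum_supp.
Qed.

End NoCliqueTheorem.

Theorem theorem1p11 (R : realType) :
  (forall (r m l : nat) (G : uniform_graph r l),
     (3 <= r)%N -> (0 < m)%N -> (0 < l)%N ->
     ('C(l - 1, r) <= m)%N ->
     m%:Z <= 'C(l - 1, r)%:Z + 'C(l - 2, r - 1)%:Z
             - (2 ^+ (r - 3) - 1) * ('C(l - 2, r - 2)%:Z - 1) ->
     #|edges G| = m ->
     has_clique G (l - 1) ->
     lagrangian R G = lagrangian R (complete_graph r (l - 1)))
  /\
  (forall (m l n : nat) (G : uniform_graph 3 n),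
     (0 < m)%N -> (0 < l)%N ->
     ('C(l - 1, 3) <= m)%N ->
     m%:Z <= 'C(l - 1, 3)%:Z + 'C(l - 2, 2)%:Z - (l%:Z - 2) ->
     #|edges G| = m ->
     ~ has_clique G (l - 1) ->
     lagrangian R G < lagrangian R (complete_graph 3 (l - 1))).
Proof.
split=> [r m l G r3 m0 l0 _|m l n G m0 l0 _ hm cG ncl].
  exact: lagrangian_near_clique.
(* For l = 1 the empty set is a clique of order 0, and for l = 2, 3, 4 the upper bound forces m <=
   0; what remains has l - 1 >= 4. *)
case: l l0 hm ncl => [|[|[|[|[|l]]]]] // _.
- move=> _ []; exists finset.set0; first by rewrite cards0.
  move=> e; rewrite finset.subset0 => /eqP ->; rewrite cards0 => //.
- by rewrite -[m%:Z <= _]/(m%:Z <= 0%:Z + 0%:Z - (2%:Z - 2)); lia.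
- by rewrite -[m%:Z <= _]/(m%:Z <= 1%:Z + 1%:Z - (4%:Z - 2)); lia.
rewrite (_ : (l.+4.+1 - 1 = l.+4)%N) ?subn1 // (_ : (l.+4.+1 - 2 = l.+3)%N) ?subn2 // => hm ncl.
apply: lagrangian_no_clique => //; rewrite cG //=; lia.
Qed.
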